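(* Let $n \geq 3$ be an integer, let $K$ be an algebraically closed field of characteristic $0$, and let $f \in K\langle x_1, x_2, x_3, x_4 \rangle$ be any nonzero multilinear polynomial. Then $[M_{n}(K), M_{n}(K)]\subseteq f(M_{n}(K))$; that is, for every matrix $D \in M_n(K)$ of trace $0$ there exist $A_1,A_2,A_3,A_4 \in M_n(K)$ with $f(A_1,A_2,A_3,A_4)=D$.
   Context: $K\langle x_1,\ldots,x_m\rangle$ denotes the free associative unital $K$-algebra in noncommuting variables $x_1,\ldots,x_m$. A multilinear polynomial in $K\langle x_1,\ldots,x_m\rangle$ is a polynomial in noncommuting variables that is linear in each variable, i.e. one of the form $\sum_{\sigma \in S_m} a_\sigma x_{\sigma(1)}x_{\sigma(2)}\cdots x_{\sigma(m)}$ with $a_\sigma\in K$, where $S_m$ is the permutation group on $m$ elements. $M_n(K)$ is the algebra of $n\times n$ matrices over $K$. $[M_n(K),M_n(K)]$ denotes the $K$-subspace of $M_n(K)$ consisting of the matrices of trace zero. $f(M_n(K))$ denotes the set of values $\{f(A_1,\ldots,A_m): A_1,\ldots,A_m\in M_n(K)\}$ of $f$ on $M_n(K)$. *)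

(* Defs.v *)
From HB Require Import structures.
From mathcomp Require Import all_boot all_order all_fingroup all_algebra.
From mathcomp Require Import finmap monalg.

Set Implicit Arguments.
Unset Strict Implicit.
Unset Printing Implicit Defensive.

Import GRing.Theory.
Local Open Scope ring_scope.

(* The free unital associative algebra K<x_0, .., x_(m-1)>, as the algebra of *)
(* the free monoid over 'I_m: its monomials are the words over 'I_m, with     *)
(* concatenation as product.                                                  *)
Notation "{ 'ncpoly' K [ m ] }" := {malg K[{fmonom 'I_m}]}
  (at level 0, K, m at level 2, format "{ 'ncpoly'  K [ m ] }") : type_scope.

Definition ncvar (K : fieldType) (m : nat) (i : 'I_m) : {ncpoly K[m]} :=
  << fmu i >>.

(* The products are ordered: the one below is x_(s 0) * .. * x_(s (m-1)).     *)
Definition multilinear (K : fieldType) (m : nat) (f : {ncpoly K[m]}) : Prop :=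
  exists a : 'S_m -> K,
    f = \sum_(s : 'S_m) a s *: \prod_(i < m) ncvar K (s i).

(* For an arbitrary n, 'M[K]_n is only a pzRingType (it is trivial if n = 0), *)
(* hence mmap, which needs a nzRingType, does not apply.                      *)
Definition nceval (K : fieldType) (m n : nat) (f : {ncpoly K[m]})
    (A : 'I_m -> 'M[K]_n) : 'M[K]_n :=
  \sum_(w <- msupp f) f@_w *: \prod_(i <- (w : seq 'I_m)) A i.

Section NcevalTheory.
Variables (K : fieldType) (m n : nat) (A : 'I_m -> 'M[K]_n).
Implicit Types (f g : {ncpoly K[m]}).

Let mon (w : {fmonom 'I_m}) : 'M[K]_n := \prod_(i <- (w : seq 'I_m)) A i.

Lemma ncevalEw (d : {fset {fmonom 'I_m}}) f : (msupp f `<=` d)%fset ->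
  nceval f A = \sum_(w <- d) f@_w *: mon w.
Proof.
move=> le; rewrite /nceval; apply: big_fset_incl => // w _ /mcoeff_outdom ->.
by rewrite scale0r.
Qed.

Lemma ncevalD f g : nceval (f + g) A = nceval f A + nceval g A.
Proof.
rewrite (ncevalEw (msuppD_le f g)) (ncevalEw (fsubsetUl _ (msupp g))).
rewrite (ncevalEw (fsubsetUr (msupp f) _)) -big_split /=.
by apply: eq_bigr => w _; rewrite mcoeffD scalerDl.
Qed.

Lemma ncevalZ c f : nceval (c *: f) A = c *: nceval f A.
Proof.
rewrite (ncevalEw (msuppZ_le c f)) /nceval scaler_sumr.
by apply: eq_bigr => w _; rewrite mcoeffZ scalerA.
Qed.

Lemma nceval0 : nceval 0 A = 0.
Proof. by rewrite -[0 in LHS](scale0r (1 : {ncpoly K[m]})) ncevalZ scale0r. Qed.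

Lemma nceval_sum (I : Type) (r : seq I) (P : pred I) (F : I -> {ncpoly K[m]}) :
  nceval (\sum_(i <- r | P i) F i) A = \sum_(i <- r | P i) nceval (F i) A.
Proof. exact: (big_morph (fun f => nceval f A) ncevalD nceval0). Qed.

Lemma ncevalU c w : nceval << c *g w >> A = c *: mon w.
Proof.
by rewrite (ncevalEw (d := [fset w]%fset)) ?msuppU_le // big_seq_fset1 mcoeffUU.
Qed.

Lemma nceval1 : nceval 1 A = 1.
Proof. by rewrite ncevalU scale1r /mon fm1 big_nil. Qed.

Lemma nceval_var i : nceval (ncvar K i) A = A i.
Proof. by rewrite ncevalU scale1r /mon fmU big_seq1. Qed.

Lemma ncevalM f g : nceval (f * g) A = nceval f A * nceval g A.
Proof.
rewrite malgME nceval_sum [nceval f A]/nceval mulr_suml.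
apply: eq_bigr => v _; rewrite nceval_sum [nceval g A]/nceval mulr_sumr.
apply: eq_bigr => w _; rewrite ncevalU /mon fmM big_cat /=.
by rewrite -!mulmxE -scalemxAl -scalemxAr scalerA.
Qed.
End NcevalTheory.

(* Main.v *)
Require Import Defs.
From mathcomp Require Import all_boot all_order all_fingroup all_algebra.
From mathcomp Require Import finmap monalg.
From mathcomp Require Import ring zify.

(** Write [f] as a combination of the words x_i x_j x_k x_l with coefficients
c i j k l. The set of values is closed under conjugation, and a traceless matrix
is similar to one with zero diagonal.

If three variables are powers u, u^2, u^4 of a generic diagonal matrix and the
fourth is arbitrary, then [f] acts entrywise; it reaches every matrix with zero
diagonal unless c is antisymmetric in its first two and in its last two places.
In that case f is a combination of the products [x_i, x_j][x_k, x_l], and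
f(u, x, y, u) = - p [u, x][u, y] - q [u, y][u, x]. When (p, q) <> (0, 0), up to
renaming the variables, the equation XY + qYX = D is solved with X and Y of zero
diagonal, i.e. in the image of ad u: bring D to Jordan form and take for X the
inverse of a cyclic permutation matrix C and for Y a combination of C and C^2
with diagonal coefficients. When all these p, q vanish, f is a multiple of the
standard polynomial s_4, which is evaluated on the same kind of matrices. *)

Set Implicit Arguments.
Unset Strict Implicit.
Unset Printing Implicit Defensive.

Import GRing.Theory.
Local Open Scope ring_scope.

(** * Similarity of matrices and reduction to zero diagonal *)

Section Similarity.
Variable K : fieldType.

Definition simmx n (A B : 'M[K]_n) : Prop :=
  exists2 P, P \in unitmx & P *m A = B *m P.

Lemma simmx_refl n (A : 'M[K]_n) : simmx A A.
Proof. by exists 1%:M; rewrite ?unitmx1 // mul1mx mulmx1. Qed.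

Lemma simmx_trans n (A B C : 'M[K]_n) : simmx A B -> simmx B C -> simmx A C.
Proof.
move=> [P uP PA] [R uR RB]; exists (R *m P); first by rewrite unitmx_mul uR.
by rewrite -mulmxA PA mulmxA RB mulmxA.
Qed.

Lemma simmx_tr n (A B : 'M[K]_n) : simmx A B -> \tr A = \tr B.
Proof.
move=> [P uP PA]; have -> : A = invmx P *m (B *m P).
  by rewrite -PA mulmxA mulVmx // mul1mx.
by rewrite mxtrace_mulC -mulmxA mulmxV // mulmx1.
Qed.

(** Conjugation by the block diagonal matrix of [1] and [P] fixes the corner [A1]; the border blocks
    may change freely. *)
Lemma simmx_block k m (A1 : 'M[K]_k) B C (A2 A2' : 'M[K]_m) :
    simmx A2 A2' ->
  exists B' C', simmx (block_mx A1 B C A2) (block_mx A1 B' C' A2').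
Proof.
move=> [P uP PA].
exists (B *m invmx P), (P *m C), (block_mx 1%:M 0 0 P).
  by rewrite unitmxE det_ublock det1 mul1r.
rewrite !mulmx_block !mul1mx !mul0mx !mulmx0 ?mulmx1 ?addr0 ?add0r.
by rewrite mulmxKV // PA.
Qed.

Lemma simmx_diag_block k m (A1 : 'M[K]_k) (A2 A2' : 'M[K]_m) :
  simmx A2 A2' -> simmx (block_mx A1 0 0 A2) (block_mx A1 0 0 A2').
Proof.
move=> [P uP PA]; exists (block_mx 1%:M 0 0 P).
  by rewrite unitmxE det_ublock det1 mul1r.
by rewrite !mulmx_block !mul1mx !mul0mx !mulmx0 ?mulmx1 ?addr0 ?add0r PA.
Qed.

Lemma simmx_perm n (A : 'M[K]_n) (s : 'S_n) :
  simmx A (\matrix_(i, j) A (s i) (s j)).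
Proof.
exists (perm_mx s); first exact: unitmx_perm.
rewrite -row_permE -[in RHS](invgK s) -col_permE invgK.
by apply/matrixP=> i j; rewrite !mxE permKV.
Qed.

Lemma simmx_scale_diag n (A : 'M[K]_n) (d : 'I_n -> K) :
  (forall i, d i != 0) -> simmx A (\matrix_(i, j) (d i * A i j / d j)).
Proof.
move=> d0; exists (diag_mx (\row_i d i)).
  rewrite unitmxE det_diag unitfE; apply/prodf_neq0 => i _.
  by rewrite mxE.
apply/matrixP=> i j; rewrite mul_diag_mx mul_mx_diag !mxE.
by rewrite mulfVK.
Qed.

(** [R] is a basis of the left kernel of [W]. As [U *m W] is invertible, this kernel meets the row
    space of [U] only in zero, and the dimensions add up to [n]. *)
Lemma basis_completion n k (U : 'M[K]_(k, n)) (W : 'M[K]_(n, k)) :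
    U *m W \in unitmx ->
  exists m (R : 'M[K]_(m, n)),
    [/\ n = (k + m)%N, R *m W = 0 & row_free (col_mx U R)].
Proof.
move=> uUW; exists (\rank (kermx W)), (row_base (kermx W)).
have rW : \rank W = k.
  apply/eqP; rewrite eqn_leq rank_leq_col /=.
  by rewrite -[X in (X <= _)%N](mxrank_unit uUW) mxrankM_maxr.
have R0 : row_base (kermx W) *m W = 0.
  by apply/sub_kermxP; rewrite eq_row_base.
split=> //.
  by rewrite mxrank_ker rW subnKC // -rW rank_leq_row.
apply: inj_row_free => v; rewrite -[v]hsubmxK mul_row_col => v0.
have l0 : lsubmx v = 0.
  apply: (can_inj (mulmxK uUW)); rewrite mul0mx mulmxA.
  have /(congr1 (mulmxr W)) /= := v0.
  by rewrite mulmxDl mul0mx -(mulmxA (rsubmx v)) R0 mulmx0 addr0.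
move: v0; rewrite l0 mul0mx add0r => r0; rewrite (_ : rsubmx v = 0) ?row_mx0 //.
by apply: (row_free_inj (row_base_free (kermx W))); rewrite r0 mul0mx.
Qed.

Lemma simmx_col_mx k m (U : 'M[K]_(k, k + m)) (R : 'M_(m, k + m)) A :
    row_free (col_mx U R) ->
  exists B11 B12 B21 B22, [/\ simmx A (block_mx B11 B12 B21 B22),
    U *m A = B11 *m U + B12 *m R & R *m A = B21 *m U + B22 *m R].
Proof.
rewrite row_free_unit => uP; pose B := col_mx U R *m A *m invmx (col_mx U R).
have BE : col_mx U R *m A = B *m col_mx U R by rewrite mulmxKV.
exists (ulsubmx B), (ursubmx B), (dlsubmx B), (drsubmx B).
move: (BE); rewrite -[in X in X -> _](submxK B) mul_col_mx mul_block_col.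
by case/eq_col_mx; split=> //; exists (col_mx U R); rewrite ?submxK.
Qed.

Lemma nonscalar_compression0 n (D : 'M[K]_n) : ~~ is_scalar_mx D ->
  exists (v : 'rV_n) (w : 'cV_n), v *m w = 1%:M /\ v *m D *m w = 0.
Proof.
move=> nsD; pose e i : 'rV[K]_n := delta_mx 0 i.
have eE i j : e i *m (e j)^T = (i == j)%:R%:M.
  apply/matrixP=> a b; rewrite !ord1 trmx_delta mul_delta_mx_cond.
  by case: (i == j); rewrite !mxE.
have eDE i j : e i *m D *m (e j)^T = (D i j)%:M.
  by apply/matrixP=> a b; rewrite !ord1 trmx_delta -colE -rowE !mxE mulr1n.
have [/existsP[i /existsP[j /andP[ij Dij]]] | dD] :=
    boolP [exists i, exists j, (i != j) && (D i j != 0)].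
  (* The multiple of [e j] in [w] cancels [D i i] and leaves the pairing with [v = e i]
     unchanged. *)
  pose c := D i i / D i j.
  exists (e i), (e i - c *: e j)^T.
  rewrite linearB linearZ !mulmxBr -!scalemxAr !eE !eDE eqxx (negPf ij).
  rewrite ?mulr0n ?(raddf0 (@scalar_mx K 1)) ?scaler0 ?subr0.
  by rewrite scale_scalar_mx divfK // subrr.
have {}dD i j : i != j -> D i j = 0.
  move=> ij; apply/eqP; apply: contraNT dD => Dij.
  by apply/existsP; exists i; apply/existsP; exists j; rewrite ij.
have /existsP[i /existsP[j Dij]] : [exists i, exists j, D i i != D j j].
  apply: contraR nsD; rewrite negb_exists => /forallP Dc.
  apply/is_scalar_mxP; case: n D dD {e eE eDE} Dc => [|n] D dD Dc.
    by exists 0; apply/matrixP=> -[].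
  exists (D 0 0); apply/matrixP=> i j; rewrite mxE.
  have [<-|ij] := eqVneq; last exact: dD.
  have := Dc i; rewrite negb_exists => /forallP /(_ 0).
  by rewrite negbK => /eqP.
have ij : i != j by apply: contraNneq Dij => ->.
(* For diagonal [D] and [v = e i + e j], the two conditions are linear in the coordinates [i] and
   [j] of [w], with determinant [D i i - D j j] up to sign. *)
pose d := (D i i - D j j)^-1.
have d0 : (D i i - D j j) * d = 1 by rewrite mulfV ?subr_eq0.
exists (e i + e j), ((- (D j j * d)) *: e i + (D i i * d) *: e j)^T.
rewrite linearD !linearZ /= !mulmxDl !mulmxDr -!scalemxAr !eE !eDE !eqxx.
split; apply/matrixP=> a b; rewrite !ord1 !mxE eqxx !mulr1n.
  rewrite (eq_sym j i) (negPf ij) !(mulr0n, mulr1n, mulr0, mulr1, addr0, add0r).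
  by rewrite -d0; ring.
by rewrite (dD _ _ ij) (dD j i) 1?eq_sym // !mulr0 addr0 add0r; ring.
Qed.

(** In a basis made of [v] and of the left kernel of [w], the first diagonal entry is
    [v *m D *m w]. *)
Lemma simmx_block0 n (D : 'M[K]_(1 + n)) : ~~ is_scalar_mx D ->
  exists g f D1, simmx D (block_mx 0 g f D1).
Proof.
case/nonscalar_compression0=> v [w [vw vDw]].
have [|m [R [/addnI enm Rw fR]]] := @basis_completion _ _ v w.
  by rewrite vw unitmx1.
case: m / enm R Rw fR => R Rw /(simmx_col_mx D)[B [g [f [D1 [sB /(congr1 (mulmxr w))]]]]] /=.
rewrite vDw mulmxDl -!mulmxA vw Rw mulmx1 mulmx0 addr0 => B0 _.
by exists g, f, D1; move: sB; rewrite -B0.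
Qed.

Lemma traceless_nonscalar n (D : 'M[K]_n.+1) :
  [pchar K] =i pred0 -> \tr D = 0 -> D != 0 -> ~~ is_scalar_mx D.
Proof.
move=> /pcharf0P K0 trD; apply: contraNN => /is_scalar_mxP[a Da].
move: trD; rewrite Da mxtrace_scalar -mulr_natr => /eqP.
by rewrite mulf_eq0 K0 orbF => /eqP->; rewrite raddf0.
Qed.

Definition hollow n (A : 'M[K]_n) := forall i, A i i = 0.

Lemma hollow_block k m (A : 'M[K]_k) B C (E : 'M[K]_m) :
  hollow A -> hollow E -> hollow (block_mx A B C E).
Proof.
move=> hA hE i; rewrite -[i]splitK; case: (split i) => j /=.
  by rewrite block_mxEul.
by rewrite block_mxEdr.
Qed.

(** Induction on the size: a nonzero traceless matrix is not scalar in characteristic 0, so its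
    first diagonal entry can be made zero, and the remaining corner is again traceless. *)
Lemma hollow_form n (D : 'M[K]_n) : [pchar K] =i pred0 -> \tr D = 0 ->
  exists2 H, simmx D H & hollow H.
Proof.
move=> K0; elim: n D => [|n IHn] D trD.
  by exists D; [apply: simmx_refl | case].
have [->|D0] := eqVneq D 0.
  by exists 0 => [|i]; [apply: simmx_refl | rewrite mxE].
have [g [f [D1 sD]]] := @simmx_block0 n D (traceless_nonscalar K0 trD D0).
have trD1 : \tr D1 = 0.
  by move: trD; rewrite (simmx_tr sD) mxtrace_block raddf0 add0r.
have [H sH hH] := IHn D1 trD1.
have [g' [f' sB]] := simmx_block 0 g f sH.
exists (block_mx 0 g' f' H) => [|i]; first exact: simmx_trans sD sB.
by apply: (@hollow_block 1) => [j|]; rewrite ?mxE.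
Qed.

(** Functions on [nat] allow [i.+1] and shifted indices without bounds; the superdiagonal shows
    [s i] for [i.+1 < n]. *)
Definition bidiag n (lam s : nat -> K) : 'M[K]_n :=
  \matrix_(i, j) (lam i *+ (j == i :> nat) + s i *+ (j == i.+1 :> nat)).

(** The superdiagonal gets a zero at [i = k - 1], where the two blocks meet. *)
Lemma bidiag_block k m lam s lam' s' :
  block_mx (bidiag k lam s) 0 0 (bidiag m lam' s') =
  bidiag (k + m) (fun i => if (i < k)%N then lam i else lam' (i - k)%N)
    (fun i => if (i.+1 < k)%N then s i else if (i < k)%N then 0 else s' (i - k)%N).
Proof.
apply/matrixP=> i j; rewrite !mxE.
case: splitP => i' ei; rewrite mxE; case: splitP => j' ej; rewrite !mxE ei ej.
- case: ltnP => // ki; rewrite [in RHS]mul0rn.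
  by rewrite [X in _ + _ *+ X](_ : _ = 0%N) // ltn_eqF // (leq_trans (ltn_ord j')).
- rewrite gtn_eqF ?ltn_addr // mulr0n add0r.
  case: ltnP => ki; last by rewrite mul0rn.
  by rewrite gtn_eqF // ltn_addr.
- rewrite !ltn_eqF ?mulr0n ?addr0 //; apply: leq_trans (ltn_ord j') _.
    by rewrite -addnS leq_addr.
  exact: leq_addr.
- rewrite -addnS ltnNge leq_addr /=.
  by rewrite addKn !eqn_add2l.
Qed.

End Similarity.

(** * Jordan form, by splitting off largest blocks *)

Section JordanForm.
Variable K : fieldType.

Lemma rank_exp_stable n (N : 'M[K]_n) :
  exists k, \rank (N ^+ k) = \rank (N ^+ k.+1).
Proof.
have H k : (exists j, \rank (N ^+ j) = \rank (N ^+ j.+1)) \/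
           (\rank (N ^+ k) + k <= n)%N.
  elim: k => [|k [?|IHk]]; [|by left|].
    by right; rewrite addn0 rank_leq_row.
  have [e|ne] := eqVneq (\rank (N ^+ k)) (\rank (N ^+ k.+1)).
    by left; exists k.
  right; rewrite addnS -addSn (leq_trans _ IHk) // leq_add2r.
  by rewrite ltn_neqAle eq_sym ne exprS mxrankM_maxr.
by case: (H n.+1) => //; rewrite addnS ltnNge leq_addl.
Qed.

(* [v] and [w] generate the two sides of a largest Jordan block of [N] for the
   eigenvalue 0, paired so that [v *m N ^+ k *m w = 1]. *)
Lemma jordan_chain n (N : 'M[K]_n) : N \notin unitmx ->
  exists k (v : 'rV_n) (w : 'cV_n),
    [/\ v *m N ^+ k.+1 = 0, N ^+ k.+1 *m w = 0 & v *m N ^+ k *m w = 1%:M].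
Proof.
move=> nuN.
(* The least exponent at which the rank stabilizes is named [k.+1]; it is not 0 because [N] is
   singular. *)
have /ex_minnP[[|k] /eqP rk kmin] :
    exists k, \rank (N ^+ k) == \rank (N ^+ k.+1).
  by have [k rk] := rank_exp_stable N; exists k; rewrite rk.
  by move: nuN; rewrite -row_free_unit /row_free -[X in \rank X](expr1 N) -rk expr0 mxrank1 eqxx.
have kerS j (v : 'rV_n) : \rank (N ^+ j) = \rank (N ^+ j.+1) ->
    v *m N ^+ j.+1 = 0 -> v *m N ^+ j = 0.
  move=> rj /sub_kermxP vj; apply/sub_kermxP; apply: submx_trans vj _.
  have sub : (kermx (N ^+ j) <= kermx (N ^+ j.+1))%MS.
    by apply/sub_kermxP; rewrite exprSr -mulmxE mulmxA mulmx_ker mul0mx.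
  by rewrite -(mxrank_leqif_sup sub) !mxrank_ker rj.
have [v vk v0] : exists2 v : 'rV_n, v *m N ^+ k.+1 = 0 & v *m N ^+ k != 0.
  have /row_subPn[i] : ~~ (kermx (N ^+ k.+1) <= kermx (N ^+ k))%MS.
    apply/negP=> sub; have := kmin k; rewrite ltnn.
    suff -> : \rank (N ^+ k) == \rank (N ^+ k.+1) by move=> /(_ isT).
    rewrite eqn_leq [X in _ && X](_ : _ = true); last by rewrite exprS mxrankM_maxr.
    move: (mxrankS sub); rewrite !mxrank_ker leq_sub2lE ?rank_leq_row //.
    by rewrite andbT.
  move=> nsub; exists (row i (kermx (N ^+ k.+1))).
    by rewrite -row_mul mulmx_ker row0.
  apply: contraNneq nsub => v0.
  by apply/sub_kermxP.
(* If [v *m N ^+ k] were [u *m N ^+ k.+1], then [N ^+ k.+2] would kill [u], hence by stability so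
   would [N ^+ k.+1]. *)
have nsub : ~~ (v *m N ^+ k <= N ^+ k.+1)%MS.
  apply/negP=> /submxP[u vu]; move/negP: v0; apply; rewrite vu.
  by rewrite (kerS _ u rk) // exprSr -mulmxE mulmxA -vu -mulmxA mulmxE -exprSr vk.
have /existsP[j cj] : [exists j, (v *m N ^+ k *m cokermx (N ^+ k.+1)) 0 j != 0].
  apply: contraR nsub; rewrite negb_exists => /forallP c0; rewrite submxE.
  by apply/eqP/rowP => j; rewrite [RHS]mxE; apply/eqP; move: (c0 j); rewrite negbK.
set c := _ 0 j in cj.
exists k, v, (c^-1 *: col j (cokermx (N ^+ k.+1))); split=> //.
  by rewrite -scalemxAr colE mulmxA mulmx_coker mul0mx scaler0.
rewrite -scalemxAr colE mulmxA -colE; apply/matrixP=> a b; rewrite !ord1.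
by rewrite mxE [X in _ * X]mxE mulVf // mxE.
Qed.

(** The rows [v *m N ^+ i] and the columns [N ^+ (k - j) *m w] of a chain span invariant spaces on
    which [A] acts by the same Jordan block. *)
Lemma jordan_block_pairing n (A : 'M[K]_n) a : A - a%:M \notin unitmx ->
  exists k (U : 'M_(k.+1, n)) (W : 'M_(n, k.+1)),
    let J := bidiag k.+1 (fun=> a) (fun=> 1) in
    [/\ U *m A = J *m U, A *m W = W *m J & U *m W \in unitmx].
Proof.
case/jordan_chain=> k [v [w []]]; set N := A - a%:M => vN Nw vNw.
have AE : A = a%:M + N by rewrite addrC subrK.
pose U := \matrix_(i < k.+1) (v *m N ^+ i).
pose W := (\matrix_(j < k.+1) (N ^+ (k - j) *m w)^T)^T.
have rU i : row i U = v *m N ^+ i by rewrite rowK.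
have cW j : col j W = N ^+ (k - j) *m w by rewrite -tr_row rowK trmxK.
set J := bidiag k.+1 (fun=> a) (fun=> 1).
have UA : U *m A = J *m U.
  apply/row_matrixP=> i; rewrite !row_mul rU AE mulmxDr -(mulmxA v _ N) mulmxE -exprSr.
  rewrite scalar_mxC mul_scalar_mx.
  have -> : row i J = a *: delta_mx 0 i +
      (if (i.+1 < k.+1)%N then delta_mx 0 (inord i.+1) else 0).
    apply/rowP => j; rewrite !mxE eqxx /=.
    case: ltnP => ik; rewrite !mxE ?eqxx /= -?val_eqE /= ?inordK // mulr_natr.
      by [].
    by rewrite [(j == i.+1 :> nat)%N]ltn_eqF // (leq_trans (ltn_ord j)).
  rewrite mulmxDl -scalemxAl -rowE rU; congr (_ + _).
  case: ltnP => ik; first by rewrite -rowE rU inordK.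
  by rewrite mul0mx (_ : i.+1 = k.+1) //; apply/eqP; rewrite eqn_leq ik ltn_ord.
have AW : A *m W = W *m J.
  apply: trmx_inj; apply/row_matrixP=> j; rewrite -!tr_col; congr (_^T).
  rewrite colE -mulmxA -colE cW AE mulmxDl mul_scalar_mx mulmxA mulmxE -exprS.
  rewrite colE -mulmxA -colE.
  have -> : col j J = a *: delta_mx j 0 +
      (if (0 < j)%N then delta_mx (inord j.-1) 0 else 0).
    apply/colP => i; rewrite !mxE eqxx /= -val_eqE /= [in RHS]eq_sym mulr_natr andbT.
    congr (_ + _); case: j => [[|j] jk] /=; rewrite !mxE //.
    by rewrite andbT -val_eqE /= inordK ?eqSS 1?eq_sym // ltnW.
  rewrite mulmxDr -scalemxAr -colE cW; congr (_ + _).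
  case: posnP => [->|j0]; first by rewrite mulmx0 subn0.
  rewrite -colE cW inordK ?(leq_ltn_trans (leq_pred _)) //.
  by rewrite -subSn ?leq_ord // -{1}(prednK j0) subSS.
have uUW : U *m W \in unitmx.
  (* Entry [(i, j)] of [U *m W] is [v *m N ^+ (i + (k - j)) *m w]: zero below the diagonal and 1 on
     it. *)
  rewrite -unitmx_tr unitmxE det_trig; last first.
    apply/is_trig_mxP => i j ij; rewrite mxE.
    have -> : (U *m W) j i = (row j U *m col i W) 0 0 by rewrite -row_mul colE mulmxA -colE !mxE.
    rewrite rU cW mulmxA -(mulmxA v) mulmxE -exprD.
    rewrite (_ : (j + (k - i) = k.+1 + (j - i).-1)%N) ?exprD -?mulmxE.
      by rewrite mulmxA vN !mul0mx mxE.
    by have := ltn_ord i; lia.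
  rewrite big1 ?unitr1 // => i _; rewrite mxE.
  have -> : (U *m W) i i = (row i U *m col i W) 0 0 by rewrite -row_mul colE mulmxA -colE !mxE.
  by rewrite rU cW mulmxA -(mulmxA v) mulmxE -exprD subnKC ?leq_ord // vNw mxE.
by exists k, U, W.
Qed.

End JordanForm.

(** Jordan form up to the scaling of the superdiagonal: only equal eigenvalues are linked. *)
Definition jordan_pair (K : fieldType) n (lam s : nat -> K) :=
  forall i, (i.+1 < n)%N -> s i != 0 -> lam i = lam i.+1.

(** Strong induction on the size. The row space of [U] and the left kernel of [W] are complementary
    and both invariant, so a Jordan block splits off. *)
Lemma jordan_form (K : closedFieldType) n (A : 'M[K]_n) :
  exists lam s, simmx A (bidiag n lam s) /\ jordan_pair n lam s.
Proof.
have [N leN] := ubnP n; elim: N n A leN => // N IHN [|n] A leN.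
  by exists (fun=> 0), (fun=> 0); split=> //; rewrite [bidiag _ _ _]thinmx0 [A]thinmx0; apply: simmx_refl.
have /closed_rootP[a ra] : size (char_poly A) != 1%N by rewrite size_char_poly.
have [|k [U [W [UA AW uUW]]]] := @jordan_block_pairing _ _ A a.
  move: ra; rewrite -eigenvalue_root_char => /eigenvalueP[v vA v0].
  apply: contra_neqN v0 => uA; apply: (can_inj (mulmxK uA)).
  by rewrite mul0mx mulmxBr vA mul_mx_scalar subrr.
have [m [R [enm RW fR]]] := basis_completion uUW.
move: A U W R leN {ra} UA AW uUW RW fR; rewrite enm => A U W R leN UA AW uUW RW fR.
have [B11 [B12 [B21 [B22 [sA UAB RAB]]]]] := simmx_col_mx A fR.
have B21_0 : B21 = 0.
  apply: (can_inj (mulmxK uUW)); rewrite mul0mx mulmxA.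
  move/(congr1 (mulmxr W)): RAB; rewrite /= mulmxDl -mulmxA AW mulmxA RW mul0mx.
  by rewrite -(mulmxA B22) RW mulmx0 addr0.
have /eq_row_mx[B11E B12E] :
    row_mx B11 B12 = row_mx (bidiag k.+1 (fun=> a) (fun=> 1)) 0.
  by apply: (row_free_inj fR); rewrite !mul_row_col -UAB UA mul0mx addr0.
have [|lam [s [sB js]]] := IHN _ B22.
  by move: leN; lia.
have := simmx_trans sA; rewrite B21_0 B11E B12E => /(_ _ (simmx_diag_block _ sB)).
rewrite bidiag_block => sA'; do 2 eexists; split; first exact: sA'.
move=> i im /=; case: ltnP => [ik|]; first by rewrite (ltnW ik).
move=> ki; case: (ltnP i k.+1) => [|ik]; first by rewrite eqxx.
rewrite subSn //; apply: js.
by move: im; lia.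
Qed.

(** * Bidiagonal forms whose superdiagonal also has sum zero *)

Section BalancedForm.
Variable K : fieldType.

Lemma mul_diag_delta m n (d : 'rV[K]_m) i (j : 'I_n) :
  diag_mx d *m delta_mx i j = d 0 i *: delta_mx i j.
Proof.
apply/matrixP=> a b; rewrite mul_diag_mx !mxE.
by case: (eqVneq a i) => [->|]; rewrite // !mulr0.
Qed.

Lemma mul_delta_diag m n (d : 'rV[K]_n) (i : 'I_m) j :
  delta_mx i j *m diag_mx d = d 0 j *: delta_mx i j.
Proof.
apply/matrixP=> a b; rewrite mul_mx_diag !mxE.
by case: (eqVneq b j) => [->|]; rewrite ?andbF ?mulr0 ?mul0r // mulrC.
Qed.

(** An entry at [(b, c)] can be created when the eigenvalue at [c] differs from those at [a] and
    [b]. The conjugating matrix is [1 + M] with [M *m M = 0]; [x] and [y] solve the two resulting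
    scalar equations. *)
Lemma simmx_link n (d : 'rV[K]_n) (a b c : 'I_n) s t :
    a != b -> b != c -> a != c -> d 0 b != d 0 c -> d 0 a != d 0 c ->
  simmx (diag_mx d + s *: delta_mx a b)
        (diag_mx d + s *: delta_mx a b + t *: delta_mx b c).
Proof.
move=> ab bc ac dbc dac; pose x := t / (d 0 c - d 0 b).
pose y := s * x / (d 0 c - d 0 a).
have xE : x * d 0 c = t + d 0 b * x.
  by rewrite -[t in RHS](@divfK _ (d 0 c - d 0 b)) ?subr_eq0 1?eq_sym // -/x; ring.
have yE : y * d 0 c = s * x + d 0 a * y.
  by rewrite -[s * x](@divfK _ (d 0 c - d 0 a)) ?subr_eq0 1?eq_sym // -/y; ring.
pose M := x *: delta_mx b c + y *: delta_mx a c : 'M_n.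
have ba : b == a = false by rewrite eq_sym (negPf ab).
have cb : c == b = false by rewrite eq_sym (negPf bc).
have ca : c == a = false by rewrite eq_sym (negPf ac).
exists (1%:M + M).
  suff /mulmx1_unit[] : (1%:M + M) *m (1%:M - M) = 1%:M by [].
  rewrite mulmxDl mul1mx mulmxBr mulmx1 (_ : M *m M = 0) ?subr0 ?subrK //.
  rewrite /M mulmxDl !mulmxDr -!scalemxAl -!scalemxAr !mul_delta_mx_cond.
  by rewrite cb ca !mulr0n !scaler0 !addr0.
rewrite [LHS]mulmxDl [RHS]mulmxDr mul1mx mulmx1 -[RHS]addrA; congr (_ + _).
rewrite /M !mulmxDl !mulmxDr -!scalemxAl -!scalemxAr !mul_delta_mx_cond.
rewrite !mul_diag_delta !mul_delta_diag cb ca ba eqxx !mulr0n !mulr1n !scaler0.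
transitivity ((x * d 0 c) *: delta_mx b c + (y * d 0 c) *: delta_mx a c : 'M[K]_n).
  by apply/matrixP=> i j; rewrite !mxE; ring.
by rewrite xE yE; apply/matrixP=> i j; rewrite !mxE; ring.
Qed.

(** Conjugation by a diagonal matrix [d] multiplies the superdiagonal entry [i] by [d i / d i.+1],
    and these ratios can be prescribed. *)
Lemma bidiag_rescale n (lam s s' : nat -> K) :
    (forall i, (s i == 0) = (s' i == 0)) ->
  simmx (bidiag n lam s) (bidiag n lam s').
Proof.
move=> ss'; pose r i := if s i == 0 then 1 else s' i / s i.
have r0 i : r i != 0.
  by rewrite /r; case: (eqVneq (s i) 0) => [_|si]; rewrite /= ?oner_eq0 // mulf_eq0 invr_eq0 -ss' (negPf si).
pose d i := (\prod_(l < i) r l)^-1.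
have d0 i : d i != 0 by rewrite invr_eq0; apply/prodf_neq0.
have dS i : d i / d i.+1 = r i.
  by rewrite /d invrK big_ord_recr /= mulrA mulVf ?mul1r // -invr_eq0 d0.
apply: (simmx_trans (simmx_scale_diag (bidiag n lam s) (fun i : 'I_n => d0 i))).
rewrite (_ : \matrix_(i, j) _ = bidiag n lam s').
  exact: simmx_refl.
apply/matrixP=> i j; rewrite !mxE mulrDr mulrDl; congr (_ + _).
  have [->|_] := eqVneq (j : nat) i; last by rewrite mulr0 mul0r.
  by rewrite !mulr1n mulrAC mulfV ?mul1r.
have [->|_] := eqVneq (j : nat) i.+1; last by rewrite mulr0 mul0r.
rewrite !mulr1n mulrAC dS /r; case: eqVneq => [si|si].
  by rewrite si mulr0; apply/esym/eqP; rewrite -ss' si.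
by rewrite divfK.
Qed.

Lemma perm3 n (a b c : 'I_n.+3) : a != b -> b != c -> a != c ->
  exists p : 'S_n.+3, [/\ p 0 = a, p (inord 1) = b & p (inord 2) = c].
Proof.
move=> ab bc ac; set i1 : 'I_n.+3 := inord 1; set i2 : 'I_n.+3 := inord 2.
have i01 : 0 != i1 by rewrite -val_eqE /= inordK.
have i02 : 0 != i2 by rewrite -val_eqE /= inordK.
have i12 : i1 != i2 by rewrite -val_eqE /= !inordK.
pose q := tperm 0 a; pose r := tperm i1 (q b); pose t := tperm i2 (r (q c)).
have q0 : q 0 = a by rewrite tpermL.
have qb0 : q b != 0 by rewrite -(inj_eq (@perm_inj _ q)) tpermK q0 eq_sym.
have qc0 : q c != 0 by rewrite -(inj_eq (@perm_inj _ q)) tpermK q0 eq_sym.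
have r0 : r 0 = 0 by rewrite tpermD // eq_sym.
have r1 : r i1 = q b by rewrite tpermL.
have rc0 : r (q c) != 0 by rewrite -[X in _ != X]r0 (inj_eq perm_inj).
have rc1 : r (q c) != i1.
  by rewrite -(inj_eq (@perm_inj _ r)) tpermK r1 (inj_eq perm_inj) eq_sym.
exists (t * r * q)%g; rewrite !permM; split.
- by rewrite (tpermD _ rc0) 1?eq_sym // r0 q0.
- by rewrite (tpermD _ rc1) 1?eq_sym // r1 tpermK.
- by rewrite tpermL !tpermK.
Qed.

Lemma tr_bidiag n (lam s : nat -> K) : \tr (bidiag n lam s) = \sum_(i < n) lam i.
Proof. by apply: eq_bigr => i _; rewrite mxE eqxx ltn_eqF // mulr0n addr0. Qed.

Lemma bidiag_single n (lam s : nat -> K) (p : nat) : (p.+1 < n.+1)%N ->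
    (forall i : nat, (i < n)%N -> i != p -> s i = 0) ->
  bidiag n.+1 lam s =
    diag_mx (\row_i lam i) + s p *: delta_mx (inord p) (inord p.+1).
Proof.
move=> pn s0; apply/matrixP=> i j; rewrite !mxE eq_sym; congr (_ + _).
rewrite -!val_eqE /= !inordK ?(ltnW pn) // mulr_natr.
have [->|ip] := eqVneq (i : nat) p; first by [].
rewrite andFb mulr0n.
have [jE|] := eqVneq (j : nat) i.+1; last by rewrite mulr0n.
by rewrite s0 // -ltnS -jE ltn_ord.
Qed.

End BalancedForm.

(** Two or more nonzero superdiagonal entries of the Jordan form can be rescaled to sum zero. A
    single one is either the whole matrix, a multiple of a matrix unit, or some eigenvalue differs
    from its own and a second, opposite entry can be linked to it. *)
Lemma balanced_form (K : closedFieldType) n (D : 'M[K]_n.+3) :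
    [pchar K] =i pred0 -> \tr D = 0 ->
  (exists i j c, i != j /\ simmx D (c *: delta_mx i j)) \/
  (exists lam s, [/\ simmx D (bidiag n.+3 lam s),
     \sum_(i < n.+3) lam i = 0 & \sum_(i < n.+2) s i = 0]).
Proof.
move=> /pcharf0P K0 trD; have [lam [s [sD js]]] := jordan_form D.
have lam0 : \sum_(i < n.+3) lam i = 0 by rewrite -(tr_bidiag _ _ s) -(simmx_tr sD).
have [/existsP[p sp]|ns] := boolP [exists p : 'I_n.+2, s p != 0]; last first.
  right; exists lam, s; split=> //; apply: big1 => i _.
  by apply/eqP; move: ns; rewrite negb_exists => /forallP/(_ i); rewrite negbK.
have [/existsP[q /andP[qp sq]]|ns] :=
    boolP [exists q : 'I_n.+2, (q != p) && (s q != 0)].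
  pose P i := s i != 0; pose m := (\sum_(i < n.+2 | i != q) P i)%N.
  have m0 : (0 < m)%N.
    by rewrite lt0n sum_nat_eq0 negb_forall; apply/existsP; exists p; rewrite eq_sym qp /= /P sp.
  (* The nonzero entries other than the one at [q] become 1, and the one at [q] becomes minus their
     number. *)
  pose s' i : K := if P i then if i == q :> nat then - m%:R else 1 else 0.
  right; exists lam, s'; split=> //.
    apply: simmx_trans sD _; apply: bidiag_rescale => i; rewrite /s' /P.
    have [|_] /= := eqVneq (s i) 0; first by rewrite eqxx.
    by case: ifP => _; rewrite ?oner_eq0 // oppr_eq0 K0 gtn_eqF.
  rewrite (bigD1 q) //= {1}/s' /P sq eqxx natr_sum addrC.
  apply/eqP; rewrite subr_eq0; apply/eqP/eq_bigr => i iq.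
  by rewrite /s' /P val_eqE (negPf iq); case: (s i != 0).
have s0 (i : nat) : (i < n.+2)%N -> i != p -> s i = 0.
  move=> ilt ip; move: ns; rewrite negb_exists => /forallP/(_ (Ordinal ilt)).
  by rewrite negb_and -val_eqE /= ip /= negbK => /eqP.
have pn : (p.+1 < n.+3)%N by rewrite ltnS ltn_ord.
have bE l := bidiag_single l pn s0.
set a := inord p in bE; set b := inord p.+1 in bE.
have av : a = p :> nat by rewrite inordK // ltnW.
have bv : b = p.+1 :> nat by rewrite inordK.
have ab : a != b by rewrite -val_eqE /= av bv ltn_eqF.
have [/existsP[c lc]|nc] := boolP [exists r : 'I_n.+3, lam r != lam p]; last first.
  left; exists a, b, (s p); split=> //.
  have lamc (i : 'I_n.+3) : lam i = lam p.
    by apply/eqP; move: nc; rewrite negb_exists => /forallP/(_ i); rewrite negbK.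
  have lamp : lam p = 0.
    move: lam0; rewrite (eq_bigr _ (fun i _ => lamc i)) sumr_const card_ord.
    by rewrite -mulr_natr => /eqP; rewrite mulf_eq0 K0 orbF => /eqP.
  apply: simmx_trans sD _; rewrite bE (_ : diag_mx _ = 0) ?add0r; first exact: simmx_refl.
  by apply/matrixP=> i j; rewrite !mxE lamc lamp mul0rn.
have lab : lam p = lam p.+1 by apply: js.
have bc : b != c by apply: contraNneq lc => <-; rewrite bv -lab.
have ac : a != c by apply: contraNneq lc => <-; rewrite av.
(* Moving [a], [b], [c] to the first three places puts both links on the superdiagonal. *)
have [g [g0 g1 g2]] := perm3 ab bc ac.
pose lam' i := lam (g (inord i)).
pose s' i : K := if i == 0%N then s p else if i == 1%N then - s p else 0.
have sD' : simmx D (bidiag n.+3 lam' s').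
  apply: simmx_trans sD _; rewrite bE.
  have := @simmx_link _ _ (\row_(i < n.+3) lam i) a b c (s p) (- s p) ab bc ac.
  rewrite !mxE av bv -lab eq_sym => /(_ lc lc) /simmx_trans; apply.
  apply: simmx_trans (simmx_perm _ g) _.
  rewrite (_ : \matrix_(_, _) _ = bidiag n.+3 lam' s'); first exact: simmx_refl.
  apply/matrixP=> i j; rewrite !mxE -g0 -g1 -g2 !(inj_eq perm_inj) -addrA.
  rewrite -!val_eqE /= !inordK // /lam' inord_val eq_sym; congr (_ + _).
  rewrite /s'; case: (i : nat) => [|[|m]]; rewrite ?mulr0 ?addr0 ?add0r ?mul0rn //.
    by rewrite mulr_natr.
  by rewrite mulr_natr.
right; exists lam', s'; split=> //.
  by rewrite -(tr_bidiag _ _ s') -(simmx_tr sD').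
by rewrite !big_ord_recl /= addrA subrr add0r big1.
Qed.

(** * Cyclic diagonals and the equation [XY + qYX = D] *)

Section CyclicDiagonals.
Variables (K : fieldType) (n : nat).
Local Notation I := 'I_n.+2.
Implicit Types (f g : I -> K) (k l : I).

(** The diagonal matrix of [f] times the power [k] of the cyclic permutation matrix; indices add
    modulo [n.+2]. *)
Definition cycdiag k f : 'M[K]_n.+2 := \matrix_(i, j) (f i *+ (j == i + k)).

Lemma eq_cycdiag k f g : f =1 g -> cycdiag k f = cycdiag k g.
Proof. by move=> fg; apply/matrixP=> i j; rewrite !mxE fg. Qed.

Lemma cycdiagM k l f g :
  cycdiag k f *m cycdiag l g = cycdiag (k + l) (fun i => f i * g (i + k)).
Proof.
apply/matrixP=> i j; rewrite !mxE (bigD1 (i + k)) //= big1 ?addr0.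
  by rewrite !mxE eqxx mulr1n mulrnAr addrA.
by move=> j' /negPf jk; rewrite !mxE jk mulr0n mul0r.
Qed.

Lemma cycdiagD k f g : cycdiag k f + cycdiag k g = cycdiag k (fun i => f i + g i).
Proof. by apply/matrixP=> i j; rewrite !mxE mulrnDl. Qed.

Lemma cycdiagN k f : - cycdiag k f = cycdiag k (fun i => - f i).
Proof. by apply/matrixP=> i j; rewrite !mxE mulNrn. Qed.

Lemma cycdiagZ k a f : a *: cycdiag k f = cycdiag k (fun i => a * f i).
Proof. by apply/matrixP=> i j; rewrite !mxE mulrnAr. Qed.

Lemma cycdiag1 : cycdiag 0 (fun=> 1) = 1%:M.
Proof. by apply/matrixP=> i j; rewrite !mxE addr0 eq_sym. Qed.

Lemma hollow_cycdiag k f : k != 0 -> hollow (cycdiag k f).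
Proof.
by move=> /negPf k0 i; rewrite mxE -subr_eq0 opprD addrA subrr add0r oppr_eq0 k0.
Qed.

Lemma val_ordS (i : I) : (i + 1 : I) = (if i == ord_max then 0 else i.+1) :> nat.
Proof.
rewrite /= [(1 %% _)%N]modn_small // addn1.
have [->|im] := eqVneq i ord_max; first by rewrite modnn.
rewrite modn_small // ltnS ltn_neqAle -ltnS ltn_ord andbT.
by move: im; rewrite -val_eqE.
Qed.

(** The condition on [s] removes the wrap-around entry in the lower left corner. *)
Lemma bidiag_cycdiag (lam s : nat -> K) : s n.+1 = 0 ->
  bidiag n.+2 lam s = cycdiag 0 (fun i => lam i) + cycdiag 1 (fun i => s i).
Proof.
move=> s0; apply/matrixP=> i j; rewrite !mxE addr0; congr (_ + _).
have -> : (j == i + 1) = (j == (i + 1 : I) :> nat) by [].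
rewrite val_ordS; case: (eqVneq i ord_max) => [->|//].
by rewrite s0 !mul0rn.
Qed.

Lemma sum_shift (f : I -> K) k : \sum_i f (i + k) = \sum_i f i.
Proof. by rewrite [RHS](reindex_inj (addIr k)). Qed.

(** [z] consists of the partial sums of [f]; the total sum being zero closes the cycle. *)
Lemma cyclic_difference f : \sum_i f i = 0 -> exists z, forall i, z (i + 1) - z i = f i.
Proof.
move=> f0; exists (fun i : I => \sum_(k < i) f (inord k)) => i; rewrite val_ordS.
have [->|im] := eqVneq; last by rewrite big_ord_recr /= addrAC subrr add0r inord_val.
rewrite big_ord0 sub0r; move: f0; rewrite big_ord_recr /= => /eqP.
rewrite addrC addr_eq0 => /eqP->; congr (- _); apply: eq_bigr => k _.
by congr f; apply: val_inj; rewrite /= inordK // ltnS ltnW.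
Qed.

(** The operator to invert is [1 - zeta S] with [S] the cyclic shift. Since [S ^ n.+2 = 1], a finite
    geometric sum inverts it up to the factor [1 - zeta ^+ n.+2]. *)
Lemma cyclic_zeta_difference zeta f : zeta ^+ n.+2 != 1 ->
  exists z, forall i, z i - zeta * z (i + 1) = f i.
Proof.
move=> z1; exists (fun i => (1 - zeta ^+ n.+2)^-1 * \sum_(k < n.+2) zeta ^+ k * f (i + k%:R)) => i.
rewrite mulrCA -mulrBr mulr_sumr -sumrB.
pose u (k : nat) := - (zeta ^+ k * f (i + k%:R)).
rewrite (eq_bigr (fun k : 'I_n.+2 => u k.+1 - u k)); last first.
  by move=> k _; rewrite /u opprK addrC exprS mulrA -addrA -natr1 [1 + _]addrC.
rewrite -(big_mkord xpredT (fun k : nat => u k.+1 - u k)) telescope_sumr // /u.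
rewrite opprK expr0 mul1r addr0 (_ : n.+2%:R = 0 :> 'I_n.+2) ?addr0; last exact: (@pchar_Zp n.+2).
rewrite (_ : _ + f i = (1 - zeta ^+ n.+2) * f i); last by ring.
by rewrite mulKf // subr_eq0 eq_sym.
Qed.

Lemma cyclic_shift_solve q f :
    (- q) ^+ n.+2 != 1 \/ q = -1 /\ \sum_i f i = 0 ->
  exists z, forall i, z (i - 1) + q * z i = f i.
Proof.
case=> [q1|[-> f0]].
  have [w wE] := cyclic_zeta_difference f q1.
  by exists (fun i => w (i + 1)) => i; rewrite subrK -[RHS]wE mulNr opprK.
have [|w wE] := @cyclic_difference (fun i => - f i); first by rewrite sumrN f0 oppr0.
by exists (fun i => w (i + 1)) => i; rewrite subrK mulN1r -[f i]opprK -wE opprB.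
Qed.

(** Multiplying by [X] lowers the cyclic degree by one, so the two diagonals of [Y] give independent
    equations [z (i - 1) + q * z i = f i]. *)
Lemma cycdiag_qcomm q (lam s : I -> K) :
    (- q) ^+ n.+2 != 1 \/ [/\ q = -1, \sum_i lam i = 0 & \sum_i s i = 0] ->
  exists z z', let X := cycdiag (-1) (fun=> 1) in
    let Y := cycdiag 1 z + cycdiag (1 + 1) z' in
    X *m Y + q *: (Y *m X) = cycdiag 0 lam + cycdiag 1 s.
Proof.
move=> H; have [z zE] : exists z, forall i, z (i - 1) + q * z i = lam i.
  by apply: cyclic_shift_solve; case: H => [|[]]; [left | right].
have [z' zE'] : exists z, forall i, z (i - 1) + q * z i = s i.
  by apply: cyclic_shift_solve; case: H => [|[]]; [left | right].
exists z, z'; rewrite /= mulmxDl mulmxDr !cycdiagM scalerDr !cycdiagZ addrACA.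
rewrite addNr subrr.
rewrite addKr addrK !cycdiagD; congr (_ + _); apply: eq_cycdiag => i.
  by rewrite mulr1 mul1r zE.
by rewrite mulr1 mul1r zE'.
Qed.

End CyclicDiagonals.

(** * Values of [[u, x][u, y] + q [u, y][u, x]] *)

Section CommutatorValues.
Variable K : fieldType.

Definition commx n (A B : 'M[K]_n) := A *m B - B *m A.

Lemma commx_conj n (P A B : 'M[K]_n) : P \in unitmx ->
  commx (invmx P *m A *m P) (invmx P *m B *m P) = invmx P *m commx A B *m P.
Proof.
by move=> uP; rewrite /commx mulmxBr mulmxBl !mulmxA !mulmxK.
Qed.

Definition qcomm_value n q (D : 'M[K]_n) := exists u x y,
  commx u x *m commx u y + q *: (commx u y *m commx u x) = D.

Lemma qcomm_value_sim n q (A B : 'M[K]_n) :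
  simmx A B -> qcomm_value q B -> qcomm_value q A.
Proof.
move=> [P uP PA] [u [x [y E]]].
exists (invmx P *m u *m P), (invmx P *m x *m P), (invmx P *m y *m P).
rewrite !commx_conj // !mulmxA !mulmxK //.
transitivity (invmx P *m B *m P); last by rewrite -mulmxA -PA mulmxA mulVmx ?mul1mx.
rewrite -E; move: (commx u x) (commx u y) => a b.
by rewrite mulmxDr mulmxDl -scalemxAr -scalemxAl !mulmxA.
Qed.

Hypothesis K0 : [pchar K] =i pred0.

Lemma eqr_nat_pchar0 i j : (i%:R == j%:R :> K) = (i == j).
Proof.
wlog ij : i j / (i <= j)%N => [H|].
  by case: (leqP i j) => [|/ltnW] /H // ji; rewrite eq_sym ji eq_sym.
have /pcharf0P K0' := K0.
by rewrite eq_sym -subr_eq0 -natrB // K0' subn_eq0 eqn_leq ij.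
Qed.

(** Commutation with this diagonal matrix multiplies entry [(i, j)] by [i - j], which is nonzero off
    the diagonal in characteristic 0. *)
Lemma hollow_commx n (X : 'M[K]_n) : hollow X ->
  exists x, commx (diag_mx (\row_i (i : nat)%:R)) x = X.
Proof.
move=> hX; exists (\matrix_(i, j) (X i j / (i%:R - j%:R))).
apply/matrixP=> i j; rewrite mxE mul_diag_mx mxE mul_mx_diag !mxE.
have [<-|ij] := eqVneq i j; first by rewrite hX !mul0r mulr0 subrr.
rewrite [X in _ - X]mulrC -mulrBl mulrC divfK // subr_eq0.
by rewrite eqr_nat_pchar0.
Qed.

Lemma qcomm_value_hollow n q (X Y : 'M[K]_n) : hollow X -> hollow Y ->
  qcomm_value q (X *m Y + q *: (Y *m X)).
Proof.
by move=> /hollow_commx[x <-] /hollow_commx[y <-]; exists (diag_mx (\row_i (i : nat)%:R)), x, y.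
Qed.

Lemma exists_third n (i j : 'I_n.+3) : i != j -> exists k, k != i /\ k != j.
Proof.
move=> ij; suff /existsP[k /andP[]] : [exists k, (k != i) && (k != j)] by exists k.
apply: contraT; rewrite negb_exists => /forallP all_ij.
have : [set: 'I_n.+3] \subset [set i; j].
  by apply/subsetP => k _; move: (all_ij k); rewrite !inE negb_and !negbK.
by move/subset_leq_card; rewrite cardsT card_ord cards2 ij.
Qed.

(** Factor the matrix unit through a third index [k]; the product in the other order vanishes. *)
Lemma qcomm_value_delta n q c (i j : 'I_n.+3) : i != j ->
  qcomm_value q (c *: delta_mx i j : 'M[K]_n.+3).
Proof.
move=> ij; have [k [ki kj]] := exists_third ij.
have hd a b (x : K) : a != b -> hollow (x *: delta_mx a b : 'M_n.+3).
  by move=> ab l; rewrite !mxE; case: eqP => [->|]; rewrite ?(negPf ab) mulr0.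
have := qcomm_value_hollow q (hd i k 1 _) (hd k j c _).
rewrite !scale1r -scalemxAr -scalemxAl !mul_delta_mx_cond eqxx (eq_sym j) (negPf ij).
rewrite mulr0n !scaler0 addr0; apply=> //; by rewrite eq_sym.
Qed.

Lemma bidiag_truncate n (lam s : nat -> K) : exists s',
  [/\ bidiag n.+2 lam s = bidiag n.+2 lam s', s' n.+1 = 0 &
      \sum_(i < n.+2) s' i = \sum_(i < n.+1) s i].
Proof.
pose s' i := if (i < n.+1)%N then s i else 0.
exists s'; split; last first.
- rewrite big_ord_recr /= {2}/s' ltnn addr0.
  by apply: eq_bigr => i _; rewrite /s' ltn_ord.
- by rewrite /s' ltnn.
apply/matrixP=> i j; rewrite !mxE /s'; congr (_ + _).
have [jE|_] := eqVneq (j : nat) i.+1; last by [].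
by rewrite -ltnS -jE ltn_ord.
Qed.

(** Size at least 3 makes the square of the cyclic matrix hollow. Invertibility of [X] is recorded
    for the bordering argument. *)
Lemma qcomm_value_bidiag n q (lam s : nat -> K) :
    (- q) ^+ n.+3 != 1 \/
      [/\ q = -1, \sum_(i < n.+3) lam i = 0 & \sum_(i < n.+2) s i = 0] ->
  exists X Y : 'M[K]_n.+3, [/\ hollow X, hollow Y, X \in unitmx &
    X *m Y + q *: (Y *m X) = bidiag n.+3 lam s].
Proof.
move=> H; have [s' [bE s'0 ss']] := bidiag_truncate n.+1 lam s.
rewrite bE bidiag_cycdiag //.
have [|z [z' E]] := @cycdiag_qcomm K n.+1 q (fun i => lam i) (fun i => s' i).
  by case: H => [|[q1 l0 s0]]; [left | right; split; rewrite ?ss'].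
exists (cycdiag (-1) (fun=> 1)), (cycdiag 1 z + cycdiag (1 + 1) z'); split=> //.
- by apply: hollow_cycdiag; rewrite oppr_eq0 oner_eq0.
- by move=> i; rewrite mxE (hollow_cycdiag z) // (hollow_cycdiag z') // addr0.
suff /mulmx1_unit[] : cycdiag (-1) (fun=> 1) *m cycdiag (1 : 'I_n.+3) (fun=> 1) = 1%:M :> 'M[K]_n.+3 by [].
by rewrite cycdiagM addNr -cycdiag1; apply: eq_cycdiag => i; rewrite mul1r.
Qed.

End CommutatorValues.

(** * The cases [q = -1], [- q] not a root of unity of order dividing the size, and bordering *)

Section CommutatorValuesClosed.
Variable K : closedFieldType.
Hypothesis K0 : [pchar K] =i pred0.

Lemma qcomm_valueN1 n (D : 'M[K]_n.+3) : \tr D = 0 -> qcomm_value (-1) D.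
Proof.
move=> trD; have [[i [j [c [ij sD]]]]|[lam [s [sD lam0 s0]]]] := balanced_form K0 trD.
  exact: qcomm_value_sim sD (qcomm_value_delta K0 _ _ ij).
apply: qcomm_value_sim sD _.
have [|X [Y [hX hY _ <-]]] := @qcomm_value_bidiag K n (-1) lam s; first by right.
exact: qcomm_value_hollow.
Qed.

Lemma qcomm_value_nonroot n q (D : 'M[K]_n.+3) :
  (- q) ^+ n.+3 != 1 -> qcomm_value q D.
Proof.
move=> qn; have [lam [s [sD _]]] := jordan_form D; apply: qcomm_value_sim sD _.
have [|X [Y [hX hY _ <-]]] := @qcomm_value_bidiag K n q lam s; first by left.
exact: qcomm_value_hollow.
Qed.

(* Solved on a corner of size [n.+3], where [- q] is not a root of unity of the
   relevant order, using that the corner of [X] is invertible. *)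
Lemma qcomm_value_root n q (D : 'M[K]_(1 + n.+3)) :
  (- q) ^+ n.+4 = 1 -> q != -1 -> \tr D = 0 -> qcomm_value q D.
Proof.
move=> qn q1 trD.
have q0 : q != 0 by apply: contra_eq_neq qn => ->; rewrite oppr0 expr0n eq_sym oner_eq0.
(* Two consecutive powers of [- q] equal to 1 would force [- q = 1]. *)
have qn' : (- q) ^+ n.+3 != 1.
  apply: contraNneq q1 => qn1; move: qn; rewrite exprS qn1 mulr1 => qE.
  by rewrite -qE opprK.
have [->|D0] := eqVneq D 0.
  rewrite -(scale0r (delta_mx ord0 ord_max : 'M[K]_(1 + n.+3))).
  exact: (qcomm_value_delta K0).
have [g [f [D1 sD]]] := simmx_block0 (traceless_nonscalar K0 trD D0).
have [lam [s [sD1 _]]] := jordan_form D1.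
have [g' [f' sB]] := simmx_block 0 g f sD1.
apply: qcomm_value_sim (simmx_trans sD sB) _.
have [|X [Y [hX hY uX <-]]] := @qcomm_value_bidiag K n q lam s; first by left.
have h0 : hollow (0 : 'M[K]_1) by move=> i; rewrite mxE.
(* The borders of the second factor are chosen so that [X *m Y] contributes exactly the column [f']
   and [q *: (Y *m X)] exactly the row [g']. *)
have := qcomm_value_hollow K0 q (hollow_block 0 0 h0 hX)
  (hollow_block (q^-1 *: (g' *m invmx X)) (invmx X *m f') h0 hY).
rewrite !mulmx_block !mul0mx !mulmx0 !add0r scale_block_mx add_block_mx.
rewrite !scaler0 !addr0 !add0r.
by rewrite mulKVmx // -scalemxAl scalerA mulfV // scale1r mulmxKV.
Qed.

End CommutatorValuesClosed.

(** * Matrices of size 3, and all [q] together *)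

Section SizeThree.
Variable K : closedFieldType.
Hypothesis K0 : [pchar K] =i pred0.

(* [N] is the regular nilpotent matrix; the image of [commx N] contains the
   bidiagonal matrices of trace zero. *)
Lemma qcomm_value_bidiag3 q (lam s x y : nat -> K) :
    x 0%N + x 1%N + x 2%N = 0 -> y 0%N + y 1%N + y 2%N = 0 ->
    (forall i, (i < 3)%N -> (1 + q) * (x i * y i) = lam i) ->
    (forall i, (i < 2)%N -> s i != 0 -> x i + q * x i.+1 != 0) ->
  qcomm_value q (bidiag 3 lam s).
Proof.
move=> x0 y0 lamE sx; pose t i := s i / (x i + q * x i.+1).
have tE i : (i < 2)%N -> t i * (x i + q * x i.+1) = s i.
  move=> i2; rewrite /t; have [->|si] := eqVneq (s i) 0; first by rewrite !mul0r.
  by rewrite divfK // sx.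
have x2 : x 2%N = - (x 0%N + x 1%N) by apply/eqP; rewrite -addr_eq0 addrC x0.
have y2 : y 2%N = - (y 0%N + y 1%N) by apply/eqP; rewrite -addr_eq0 addrC y0.
(* Partial sums below the diagonal give [[N, L z]] the diagonal [z]; differences of the entries of
   [d] give [[N, d]] the superdiagonal [t]. *)
pose L (z : nat -> K) : 'M[K]_3 := \matrix_(i, j)
  if (i == 1 :> nat) && (j == 0 :> nat) then z 0%N else
  if (i == 2 :> nat) && (j == 1 :> nat) then z 0%N + z 1%N else 0.
pose d : 'M[K]_3 := diag_mx (\row_i if i == 0 :> nat then 0 else
  if i == 1 :> nat then t 0%N else t 0%N + t 1%N).
pose N : 'M[K]_3 := bidiag 3 (fun=> 0) (fun=> 1).
have NX : commx N (L x) = bidiag 3 x (fun=> 0).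
  apply/matrixP=> -[[|[|[|i]]] //= hi] [[|[|[|j]]] //= hj];
    rewrite !mxE !big_ord_recl !big_ord0 !mxE /= ?x2; ring.
have NY : commx N (L y + d) = bidiag 3 y t.
  apply/matrixP=> -[[|[|[|i]]] //= hi] [[|[|[|j]]] //= hj];
    rewrite !mxE !big_ord_recl !big_ord0 !mxE /= ?y2; ring.
exists N, (L x), (L y + d); rewrite NX NY.
transitivity (bidiag 3 (fun i => (1 + q) * (x i * y i))
    (fun i => t i * (x i + q * x i.+1)) : 'M[K]_3).
  apply/matrixP=> -[[|[|[|i]]] //= hi] [[|[|[|j]]] //= hj];
    rewrite !mxE !big_ord_recl !big_ord0 !mxE /=; ring.
apply/matrixP=> i j; rewrite !mxE lamE //; congr (_ + _).
have [jE|] := eqVneq (j : nat) i.+1; last by rewrite !mulr0n.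
by rewrite tE // -ltnS -jE ltn_ord.
Qed.

(** Here [- q] is a primitive cube root of unity. Two triples [x], [y] of sum zero with prescribed
    products are needed; when some [lam i] is zero they are explicit, with [x i = 0]. *)
Lemma qcomm_value_bidiag3_all q (lam s : nat -> K) :
    q ^+ 2 - q + 1 = 0 -> lam 0%N + lam 1%N + lam 2%N = 0 -> jordan_pair 3 lam s ->
  qcomm_value q (bidiag 3 lam s).
Proof.
move=> qE lam0 js; have /pcharf0P K0' := K0.
have n0 m : m.+1%:R != 0 :> K by rewrite K0'.
have q0 : q != 0.
  by apply: contra_eq_neq qE => ->; rewrite expr0n subr0 add0r oner_eq0.
have q1 : 1 - q != 0.
  by apply: contra_eq_neq qE => /eqP; rewrite subr_eq0 => /eqP<-; rewrite expr1n subrr add0r oner_eq0.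
have qS : 1 + q != 0.
  apply: contra_eq_neq qE => /eqP; rewrite addrC addr_eq0 => /eqP->.
  by rewrite (_ : (-1) ^+ 2 - -1 + 1 = 3%:R); [exact: n0 | ring].
have lam2 : lam 2%N = - (lam 0%N + lam 1%N) by apply/eqP; rewrite -addr_eq0 addrC lam0.
pose sel3 (a b c : K) i := if i == 0%N then a else if i == 1%N then b else c.
have [l0|l0] := eqVneq (lam 0%N) 0.
  pose c := lam 1%N / (1 + q).
  apply: (@qcomm_value_bidiag3 _ _ _ (sel3 0 1 (- 1)) (sel3 (- (c + c)) c c)).
  - by rewrite /sel3 /=; ring.
  - by rewrite /sel3 /=; ring.
  - by case=> [|[|[|i]]] // _; rewrite /sel3 /= ?l0 ?lam2 ?l0 /c; field.
  - case=> [|[|i]] // _ _; rewrite /sel3 /=; first by rewrite add0r mulr1.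
    by rewrite mulrN1.
have [l1|l1] := eqVneq (lam 1%N) 0.
  pose c := lam 0%N / (1 + q).
  apply: (@qcomm_value_bidiag3 _ _ _ (sel3 1 0 (- 1)) (sel3 c (- (c + c)) c)).
  - by rewrite /sel3 /=; ring.
  - by rewrite /sel3 /=; ring.
  - by case=> [|[|[|i]]] // _; rewrite /sel3 /= ?l1 ?lam2 ?l1 /c; field.
  - case=> [|[|i]] // _ _; rewrite /sel3 /=; first by rewrite mulr0 addr0 oner_eq0.
    by rewrite add0r mulrN1 oppr_eq0.
have [l2|l2] := eqVneq (lam 2%N) 0.
  have l1E : lam 1%N = - lam 0%N by apply/eqP; rewrite -addr_eq0 addrC -oppr_eq0 -lam2 l2.
  pose c := lam 0%N / (1 + q).
  apply: (@qcomm_value_bidiag3 _ _ _ (sel3 1 (- 1) 0) (sel3 c c (- (c + c)))).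
  - by rewrite /sel3 /=; ring.
  - by rewrite /sel3 /=; ring.
  - by case=> [|[|[|i]]] // _; rewrite /sel3 /= ?l2 ?l1E /c; field.
  - case=> [|[|i]] // _ _; rewrite /sel3 /=; first by rewrite mulrN1.
    by rewrite mulr0 addr0 oppr_eq0 oner_eq0.
(* With [x = (r, 1, - (r + 1))] and [y i = c i / x i], the condition that [y] has sum zero becomes
   this quadratic equation in [r]. *)
have [r rE] := @solve_monicpoly K 2
  (nth 0 [:: - (lam 0%N / lam 1%N); - (2 * (lam 0%N + lam 1%N) / lam 1%N)]) isT.
have {}rE : lam 1%N * r ^+ 2 + 2 * (lam 0%N + lam 1%N) * r + lam 0%N = 0.
  by move: rE; rewrite !big_ord_recl big_ord0 /= => ->; field.
have r0 : r != 0.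
  by apply: contra_eq_neq rE => ->; rewrite expr0n !mulr0 !add0r.
have r1 : r + 1 != 0.
  apply: contra_eq_neq rE => /eqP; rewrite addr_eq0 => /eqP->.
  by rewrite [X in X != 0](_ : _ = lam 2%N) // lam2; ring.
pose c i := lam i / (1 + q).
apply: (@qcomm_value_bidiag3 _ _ _ (sel3 r 1 (- (r + 1)))
  (sel3 (c 0%N / r) (c 1%N) (- (c 2%N / (r + 1))))).
- by rewrite /sel3 /=; ring.
- rewrite /sel3 /= /c lam2; apply: (mulfI (mulf_neq0 (mulf_neq0 qS r0) r1)).
  by rewrite mulr0 -[RHS]rE; field; rewrite r0 r1 qS.
- by case=> [|[|[|i]]] // _; rewrite /sel3 /= /c; field; rewrite ?qS ?r0 ?r1.
(* A vanishing denominator means [r = - q]. With two equal eigenvalues at the link, the quadratic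
   equation then makes an eigenvalue zero. *)
- case=> [|[|i]] // _ si; rewrite /sel3 /=.
    have l01 := js 0%N isT si; apply: contra_neqN l0 => /eqP rq.
    have {rq} rq : r = - q by apply/eqP; rewrite -addr_eq0 -[q]mulr1 rq.
    apply: (mulIf (mulf_neq0 q0 (n0 2))).
    rewrite mul0r -[LHS]opprK -[RHS]oppr0 -[in RHS]rE rq -l01; congr (- _).
    transitivity (lam 0%N * (q ^+ 2 - q + 1) - lam 0%N * (q * 3)); last by ring.
    by rewrite qE; ring.
  have l12 := js 1%N isT si; apply: contra_neqN l1 => /eqP rq.
  have {rq}rq : r = - q.
    have : q * (r + q) = 0.
      transitivity ((q ^+ 2 - q + 1) - (1 + q * - (r + 1))); first by ring.
      by rewrite qE rq subr0.
    by move/eqP; rewrite mulf_eq0 (negPf q0) addr_eq0 => /eqP.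
  have l0E : lam 0%N = - (lam 1%N + lam 1%N).
    by rewrite {2}l12 lam2; ring.
  apply: (mulIf (mulf_neq0 q1 (n0 2))).
  rewrite mul0r -[LHS]opprK -[RHS]oppr0 -[in RHS]rE rq l0E; congr (- _).
  transitivity (lam 1%N * (q ^+ 2 - q + 1) + lam 1%N * (3 * (q - 1))); last by ring.
  by rewrite qE; ring.
Qed.

(** Bordering would leave a corner of size 2, too small for the cyclic construction, so size 3 is
    treated separately. *)
Lemma qcomm_value_root3 q (D : 'M[K]_3) :
  (- q) ^+ 3 = 1 -> q != -1 -> \tr D = 0 -> qcomm_value q D.
Proof.
move=> q3 q1 trD; have [lam [s [sD js]]] := jordan_form D.
apply: (qcomm_value_sim sD); apply: qcomm_value_bidiag3_all js.
  have : (q + 1) * (q ^+ 2 - q + 1) == 0.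
    by rewrite (_ : _ * _ = 1 - (- q) ^+ 3); [rewrite q3 subrr | ring].
  by rewrite mulf_eq0 addr_eq0 (negPf q1) => /eqP.
by move: trD; rewrite (simmx_tr sD) tr_bidiag !big_ord_recl big_ord0 addr0 addrA.
Qed.


Lemma qcomm_value_traceless n q (D : 'M[K]_n.+3) : \tr D = 0 -> qcomm_value q D.
Proof.
move=> trD; have [->|q1] := eqVneq q (-1); first exact: qcomm_valueN1.
have [qn|qn] := eqVneq ((- q) ^+ n.+3) 1; last exact: qcomm_value_nonroot.
by case: n D trD qn => [|n] D trD qn; [apply: qcomm_value_root3 | apply: qcomm_value_root].
Qed.

End SizeThree.

(** * Values of the standard polynomial [s_4] *)

Section StandardPolynomial.
Variable K : fieldType.

(** [s_4] written through commutators: the alternating sum over the three splittings of the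
    variables into two pairs. *)
Definition std4 n (A B C E : 'M[K]_n) :=
  (commx A B *m commx C E + commx C E *m commx A B)
  - (commx A C *m commx B E + commx B E *m commx A C)
  + (commx A E *m commx B C + commx B C *m commx A E).

Lemma std4_conj n (P A B C E : 'M[K]_n) : P \in unitmx ->
  std4 (invmx P *m A *m P) (invmx P *m B *m P) (invmx P *m C *m P)
    (invmx P *m E *m P) = invmx P *m std4 A B C E *m P.
Proof.
move=> uP; rewrite /std4 !commx_conj //.
move: (commx A B) (commx C E) (commx A C) (commx B E) (commx A E) (commx B C).
move=> a b c d e f; rewrite !mulmxA !mulmxK //.
by rewrite !(mulmxDr, mulmxDl, mulmxN, mulNmx) !mulmxA.
Qed.

Definition std4_value n (D : 'M[K]_n) := exists A B C E, std4 A B C E = D.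

Lemma std4_value_sim n (A B : 'M[K]_n) :
  simmx A B -> std4_value B -> std4_value A.
Proof.
move=> [P uP PA] [a [b [c [e E]]]].
exists (invmx P *m a *m P), (invmx P *m b *m P), (invmx P *m c *m P), (invmx P *m e *m P).
by rewrite std4_conj // E -mulmxA -PA mulmxA mulVmx ?mul1mx.
Qed.

Lemma commxDr n (A B C : 'M[K]_n) : commx A (B + C) = commx A B + commx A C.
Proof. by rewrite /commx mulmxDr mulmxDl opprD addrACA. Qed.

Lemma commx_cycdiag n (k l : 'I_n.+2) (f g : 'I_n.+2 -> K) :
  commx (cycdiag k f) (cycdiag l g) =
  cycdiag (k + l) (fun i => f i * g (i + k) - g i * f (i + l)).
Proof. by rewrite /commx !cycdiagM (addrC l) cycdiagN cycdiagD. Qed.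

(** The first and third arguments commute, so one splitting drops out. The remaining terms have
    cyclic degree 0 or 1 and involve only the differences of [tau], [g] and [h]. *)
Lemma std4_cycdiag n (tau m g l h k : 'I_n.+2 -> K) :
    (forall i, tau (i + 1) - tau i = m i) ->
    (forall i, g (i + 1) - g i = l i) -> (forall i, h (i + 1) - h i = k i) ->
  std4 (cycdiag 1 (fun=> 1)) (cycdiag 1 tau) (cycdiag (-1) (fun=> 1))
    (cycdiag (-1) g + cycdiag 0 h) =
  cycdiag 0 (fun i => 2 * (m (i - 1) * l i) - m i * l (i + 1)
                      - m (i - 1 - 1) * l (i - 1)) +
  cycdiag 1 (fun i => m i * (k i - k (i + 1)) + m (i - 1) * (k i - k (i - 1))).
Proof.
move=> mE lE kE; rewrite /std4.
have -> : commx (cycdiag 1 (fun=> 1)) (cycdiag 1 tau) = cycdiag (1 + 1) m.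
  by rewrite commx_cycdiag; apply: eq_cycdiag => i; rewrite mul1r mulr1 mE.
have -> : commx (cycdiag 1 (fun=> 1)) (cycdiag (-1) (fun=> 1)) = 0 :> 'M[K]_n.+2.
  by rewrite commx_cycdiag; apply/matrixP=> i j; rewrite !mxE subrr mul0rn.
have -> : commx (cycdiag 1 tau) (cycdiag (-1) (fun=> 1)) = cycdiag 0 (fun i => m (i - 1)).
  rewrite commx_cycdiag subrr; apply: eq_cycdiag => i.
  by rewrite mul1r mulr1 -mE subrK.
have -> : commx (cycdiag (-1) (fun=> 1)) (cycdiag (-1) g + cycdiag 0 h) =
    cycdiag (-1 - 1) (fun i => - l (i - 1)) + cycdiag (-1) (fun i => - k (i - 1)).
  rewrite commxDr !commx_cycdiag addr0; congr (_ + _); apply: eq_cycdiag => i.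
    by rewrite mul1r mulr1 -lE subrK opprB.
  by rewrite mul1r mulr1 -kE subrK opprB.
have -> : commx (cycdiag 1 (fun=> 1)) (cycdiag (-1) g + cycdiag 0 h) =
    cycdiag 0 l + cycdiag 1 k.
  rewrite commxDr !commx_cycdiag subrr addr0; congr (_ + _); apply: eq_cycdiag => i.
    by rewrite mul1r mulr1 -lE.
  by rewrite mul1r mulr1 -kE.
rewrite !mul0mx !mulmx0 addr0 subr0 !mulmxDl !mulmxDr !cycdiagM.
rewrite !add0r !addr0 !addrA !addrK.
have e0 : -1 - 1 + 1 + 1 = 0 :> 'I_n.+2 by rewrite !subrK addNr.
rewrite addNr subrr add0r e0.
apply/matrixP=> i j; rewrite !mxE !addr0 !addrA !addrK.
move: (j == i) (j == i + 1) => a b.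
move: (i - 1 - 1) (i - 1) (i + 1) => i3 i2 i1.
by case: a; case: b; rewrite ?mulr1n ?mulr0n; ring.
Qed.

(** The solution [z] is unique up to a constant, which is used to make a weighted sum vanish. *)
Lemma cyclic_difference_weighted n (v f : 'I_n.+2 -> K) :
    \sum_i v i != 0 -> \sum_i f i = 0 ->
  exists z, (forall i, z (i + 1) - z i = f i) /\ \sum_i v i * z i = 0.
Proof.
move=> v0 /cyclic_difference[z zE]; pose c := (\sum_i v i * z i) / (\sum_i v i).
exists (fun i => z i - c); split=> [i|]; first by rewrite opprB addrA subrK zE.
rewrite (eq_bigr (fun i => v i * z i - v i * c)); last by move=> i _; rewrite mulrBr.
by rewrite sumrB -mulr_suml mulrC divfK ?subrr.
Qed.

Hypothesis K0 : [pchar K] =i pred0.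

Lemma std4_value_cycdiag n (lam s : 'I_n.+3 -> K) :
    \sum_i lam i = 0 -> \sum_i s i = 0 ->
  std4_value (cycdiag 0 lam + cycdiag 1 s).
Proof.
move=> lam0 s0; have /pcharf0P K0' := K0.
have n0 m : m.+1%:R != 0 :> K by rewrite K0'.
(* A nowhere zero choice with sum 0, whose inverses have the nonzero sum [n.+2 - 1 / n.+2]. *)
pose m (i : 'I_n.+3) : K := if i == 0 then - n.+2%:R else 1.
have m0 i : m i != 0 by rewrite /m; case: ifP => _; rewrite ?oner_eq0 // oppr_eq0.
have sm : \sum_i m i = 0.
  rewrite big_ord_recl /m eqxx (eq_bigr (fun=> 1)) //.
  by rewrite sumr_const card_ord addNr.
have smV : \sum_i (m i)^-1 != 0.
  rewrite big_ord_recl {1}/m eqxx (eq_bigr (fun=> 1)); last by move=> i _; rewrite /m /= invr1.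
  rewrite sumr_const card_ord invrN addrC subr_eq0.
  apply/negP => /eqP e; have := mulfV (n0 n.+1); rewrite -e -natrM.
  by move/eqP; rewrite -[1]/(1%:R) (eqr_nat_pchar0 K0).
have sm1 : \sum_i (m (i - 1))^-1 != 0 by rewrite (sum_shift (fun i => (m i)^-1)).
have s1 : \sum_(i : 'I_n.+3) 1 != 0 :> K by rewrite sumr_const card_ord.
have [tau tauE] := cyclic_difference sm.
(* With [l i = e i / m (i - 1)] the diagonal is minus the second difference of [e]. Summing [lam]
   twice gives [e], and the weight makes [l] have sum zero, hence a difference of some [g]. *)
have [|p [pE p0]] := @cyclic_difference_weighted _ (fun=> 1) (fun i => - lam (i + 1)) s1.
  by rewrite sumrN sum_shift lam0 oppr0.
have {}p0 : \sum_i p i = 0 by rewrite -[RHS]p0; apply: eq_bigr => i _; rewrite mul1r.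
have [e [eE e0]] := cyclic_difference_weighted sm1 p0.
have [g gE] := cyclic_difference e0.
(* The superdiagonal is [M i - M (i - 1)] for [M i = m i * (k i - k (i + 1))]; each normalization
   allows the next summation, down to [h]. *)
have [|M [ME M0]] := @cyclic_difference_weighted _ (fun i => (m i)^-1) (fun i => s (i + 1)) smV.
  by rewrite sum_shift.
have [|k [kE k0]] := @cyclic_difference_weighted _ (fun=> 1) (fun i => - ((m i)^-1 * M i)) s1.
  by rewrite sumrN M0 oppr0.
have {}k0 : \sum_i k i = 0 by rewrite -[RHS]k0; apply: eq_bigr => i _; rewrite mul1r.
have [h hE] := cyclic_difference k0.
exists (cycdiag 1 (fun=> 1)), (cycdiag 1 tau), (cycdiag (-1) (fun=> 1)), (cycdiag (-1) g + cycdiag 0 h).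
rewrite (std4_cycdiag tauE gE hE).
congr (_ + _); apply: eq_cycdiag => i.
  rewrite addrK !mulVKf // -[lam i]opprK -[in RHS](subrK 1 i) -pE subrK.
  rewrite -(eE i) -(eE (i - 1)) subrK; ring.
have kE' j : k j - k (j + 1) = (m j)^-1 * M j by rewrite -opprB kE opprK.
have -> : k i - k (i - 1) = - ((m (i - 1))^-1 * M (i - 1)).
  by rewrite -kE' subrK opprB.
by rewrite kE' mulrN !mulVKf // -[in RHS](subrK 1 i) -ME subrK.
Qed.

(** Of the 24 products of these matrices only the one in the given order is nonzero. *)
Lemma std4_value_delta n c (i j : 'I_n.+3) : i != j ->
  std4_value (c *: delta_mx i j : 'M[K]_n.+3).
Proof.
move=> ij; have [k [ki kj]] := exists_third ij.
exists (delta_mx i i), (c *: delta_mx i k), (delta_mx k k), (delta_mx k j).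
rewrite /std4 /commx -!scalemxAr -!scalemxAl !mul_delta_mx_cond !eqxx.
rewrite !(eq_sym j) !(eq_sym k) in ki kj *.
rewrite (negPf ij) (negPf ki) (negPf kj).
rewrite !(mulr0n, mulr1n, scaler0, subr0, sub0r, mul0mx, mulmx0, addr0, add0r, oppr0).
by rewrite -!scalemxAr -!scalemxAl !mul_delta_mx_cond eqxx (eq_sym j) (negPf ij) mulr0n scaler0 addr0.
Qed.

End StandardPolynomial.

Lemma std4_value_traceless (K : closedFieldType) n (D : 'M[K]_n.+3) :
  [pchar K] =i pred0 -> \tr D = 0 -> std4_value D.
Proof.
move=> K0 trD; have [[i [j [c [ij sD]]]]|[lam [s [sD lam0 s0]]]] := balanced_form K0 trD.
  exact: std4_value_sim sD (std4_value_delta c ij).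
have [s' [bE s'0 ss']] := bidiag_truncate n.+1 lam s.
apply: (std4_value_sim sD); rewrite bE bidiag_cycdiag //.
by apply: std4_value_cycdiag => //; rewrite ss'.
Qed.

(** * Multilinear polynomials of degree 4 as coefficient sums *)

Section MultilinearValues.
Variable K : fieldType.
Implicit Types c : 'I_4 -> 'I_4 -> 'I_4 -> 'I_4 -> K.

Definition wsum c n (A : 'I_4 -> 'M[K]_n) : 'M[K]_n :=
  \sum_i \sum_j \sum_k \sum_l c i j k l *: (A i *m A j *m A k *m A l).

(** Four free indices make reindexing easy; this condition confines the coefficients to
    permutations. *)
Definition mlcoef c := forall i j k l, ~~ uniq [:: i; j; k; l] -> c i j k l = 0.

Definition o0 : 'I_4 := @Ordinal 4 0 isT.
Definition o1 : 'I_4 := @Ordinal 4 1 isT.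
Definition o2 : 'I_4 := @Ordinal 4 2 isT.
Definition o3 : 'I_4 := @Ordinal 4 3 isT.

Lemma sum_ord4 (V : nmodType) (F : 'I_4 -> V) :
  \sum_i F i = F o0 + F o1 + F o2 + F o3.
Proof.
rewrite !big_ord_recl big_ord0 addr0 !addrA.
by congr (F _ + F _ + F _ + F _); apply: val_inj.
Qed.

(** The 24 words are grouped in fours, by the set of the first two letters, ready to combine into
    products of commutators. *)
Lemma wsumE c n (A : 'I_4 -> 'M[K]_n) : mlcoef c ->
  let T i j k l := c i j k l *: (A i *m A j *m A k *m A l) in
  wsum c A =
    T o0 o1 o2 o3 + T o0 o1 o3 o2 + T o1 o0 o2 o3 + T o1 o0 o3 o2 +
    (T o2 o3 o0 o1 + T o2 o3 o1 o0 + T o3 o2 o0 o1 + T o3 o2 o1 o0) +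
    (T o0 o2 o1 o3 + T o0 o2 o3 o1 + T o2 o0 o1 o3 + T o2 o0 o3 o1) +
    (T o1 o3 o0 o2 + T o1 o3 o2 o0 + T o3 o1 o0 o2 + T o3 o1 o2 o0) +
    (T o0 o3 o1 o2 + T o0 o3 o2 o1 + T o3 o0 o1 o2 + T o3 o0 o2 o1) +
    (T o1 o2 o0 o3 + T o1 o2 o3 o0 + T o2 o1 o0 o3 + T o2 o1 o3 o0).
Proof.
move=> c0 T; rewrite /wsum.
have T0 i j k l : T i j k l = if uniq [:: i; j; k; l] then T i j k l else 0.
  by case: ifP => // /negbT /c0 e; rewrite /T e scale0r.
under eq_bigr => i _ do under eq_bigr => j _ do under eq_bigr => k _ do
  under eq_bigr => l _ do rewrite -/(T i j k l) T0.
rewrite !sum_ord4 /= !(addr0, add0r).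
move: T {T0} => T.
apply/matrixP => a b; rewrite !mxE.
ring.
Qed.

End MultilinearValues.

(** * Symmetries of the problem and evaluation on diagonal matrices *)

Section TracelessValues.
Variable K : fieldType.
Implicit Types c : 'I_4 -> 'I_4 -> 'I_4 -> 'I_4 -> K.

Definition traceless_values n c :=
  forall D : 'M[K]_n, \tr D = 0 -> exists A, wsum c A = D.

Lemma wsum_conj c n (P : 'M[K]_n) (A : 'I_4 -> 'M[K]_n) : P \in unitmx ->
  wsum c (fun i => invmx P *m A i *m P) = invmx P *m wsum c A *m P.
Proof.
move=> uP; rewrite /wsum mulmx_sumr mulmx_suml; apply: eq_bigr => i _.
rewrite mulmx_sumr mulmx_suml; apply: eq_bigr => j _.
rewrite mulmx_sumr mulmx_suml; apply: eq_bigr => k _.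
rewrite mulmx_sumr mulmx_suml; apply: eq_bigr => l _.
by rewrite -scalemxAr -scalemxAl !mulmxA !mulmxK.
Qed.

Lemma traceless_values_hollow n c : [pchar K] =i pred0 ->
    (forall H : 'M[K]_n, hollow H -> exists A, wsum c A = H) ->
  traceless_values n c.
Proof.
move=> K0 vH D trD; have [H [P uP PD] /vH[A AE]] := hollow_form K0 trD.
exists (fun i => invmx P *m A i *m P).
by rewrite wsum_conj // AE -mulmxA -PD mulmxA mulVmx ?mul1mx.
Qed.

Lemma traceless_values_relabel n c (h : 'I_4 -> 'I_4) : injective h ->
    traceless_values n (fun i j k l => c (h i) (h j) (h k) (h l)) ->
  traceless_values n c.
Proof.
move=> hI v D /v[A AE]; exists (A \o invF hI); rewrite -AE /wsum.
rewrite (reindex_inj hI); apply: eq_bigr => i _.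
rewrite (reindex_inj hI); apply: eq_bigr => j _.
rewrite (reindex_inj hI); apply: eq_bigr => k _.
rewrite (reindex_inj hI); apply: eq_bigr => l _.
by rewrite /= !invF_f.
Qed.

(** Transposition reverses every word and preserves the trace. *)
Lemma traceless_values_rev n c :
  traceless_values n (fun i j k l => c l k j i) -> traceless_values n c.
Proof.
move=> v D; rewrite -mxtrace_tr => /v[A AE]; exists (fun i => (A i)^T).
apply: trmx_inj; rewrite -AE /wsum.
have trS (F : 'I_4 -> 'M[K]_n) : (\sum_i F i)^T = \sum_i (F i)^T by rewrite raddf_sum.
rewrite trS; under eq_bigr => i _ do rewrite trS.
under eq_bigr => i _ do under eq_bigr => j _ do rewrite trS.
under eq_bigr => i _ do under eq_bigr => j _ do under eq_bigr => k _ do rewrite trS.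
under eq_bigr => i _ do under eq_bigr => j _ do under eq_bigr => k _ do
  under eq_bigr => l _ do rewrite linearZ /= !trmx_mul !trmxK !mulmxA.
(* Six exchanges of adjacent sums reverse the order of the four indices. *)
under [RHS]eq_bigr => i _ do under eq_bigr => j _ do rewrite exchange_big.
under [RHS]eq_bigr => i _ do rewrite exchange_big.
under [RHS]eq_bigr => i _ do under eq_bigr => j _ do rewrite exchange_big.
rewrite [RHS]exchange_big.
under [RHS]eq_bigr => i _ do rewrite exchange_big.
by under [RHS]eq_bigr => i _ do under eq_bigr => j _ do rewrite exchange_big.
Qed.

(* The variable in slot 2 is arbitrary and the others are powers of one diagonal
   matrix, with exponents 1, 2, 4 so that distinct sets of variables standing
   before slot 2 give distinct monomials. *)
Definition slot_sum c (e : nat) : K := nth 0 [::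
  c o2 o0 o1 o3 + c o2 o0 o3 o1 + c o2 o1 o0 o3 + c o2 o1 o3 o0 + c o2 o3 o0 o1 + c o2 o3 o1 o0;
  c o0 o2 o1 o3 + c o0 o2 o3 o1;
  c o1 o2 o0 o3 + c o1 o2 o3 o0;
  c o0 o1 o2 o3 + c o1 o0 o2 o3;
  c o3 o2 o0 o1 + c o3 o2 o1 o0;
  c o0 o3 o2 o1 + c o3 o0 o2 o1;
  c o1 o3 o2 o0 + c o3 o1 o2 o0;
  c o0 o1 o3 o2 + c o0 o3 o1 o2 + c o1 o0 o3 o2 + c o1 o3 o0 o2 + c o3 o0 o1 o2 + c o3 o1 o0 o2] e.

(** Letters before [Y] give powers of [u a] and letters after it powers of [u b], with total
    exponent 1 + 2 + 4 = 7. *)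
Lemma wsum_slot c n (u : 'I_n -> K) (Y : 'M[K]_n) (a b : 'I_n) : mlcoef c ->
  let A (i : 'I_4) := nth 0 [:: diag_mx (\row_i u i); diag_mx (\row_i u i ^+ 2); Y;
                      diag_mx (\row_i u i ^+ 4)] i in
  wsum c A a b = Y a b * \sum_(e < 8) slot_sum c e * (u a ^+ e * u b ^+ (7 - e)).
Proof.
move=> c0 A; rewrite wsumE // !big_ord_recl big_ord0 /A /slot_sum /=.
rewrite !mulmx_diag !mul_diag_mx !mul_mx_diag !mxE.
ring.
Qed.

End TracelessValues.

(** * Case analysis on the coefficients *)

Section ClosedField.
Variable K : closedFieldType.
Hypothesis K0 : [pchar K] =i pred0.
Implicit Types c : 'I_4 -> 'I_4 -> 'I_4 -> 'I_4 -> K.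

(** Take [u i = t ^+ i]. For [a != b] the exponents [a * e + b * (d - e)] are distinct, so each form
    is a nonzero polynomial in [t], and some [t] is a root of none. *)
Lemma nonvanishing_form n (C : nat -> K) (d m : nat) : (m <= d)%N -> C m != 0 ->
  exists u : 'I_n -> K, forall a b, a != b ->
    \sum_(e < d.+1) C e * (u a ^+ e * u b ^+ (d - e)) != 0.
Proof.
move=> md Cm; pose P (a b : 'I_n) : {poly K} :=
  \sum_(e < d.+1) C e *: 'X^(a * e + b * (d - e)).
have P0 a b : a != b -> P a b != 0.
  move=> ab; apply: contraNneq Cm => /(congr1 (fun p : {poly K} => p`_(a * m + b * (d - m)))).
  rewrite coef0 coef_sum (bigD1 (inord m)) //= big1 => [|e em].
    by rewrite addr0 coefZ coefXn inordK // eqxx mulr1 => ->.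
  rewrite coefZ coefXn; case: eqP => [E|_]; last by rewrite mulr0.
  case/negP: em; rewrite -val_eqE /= inordK //; apply/eqP.
  have := ltn_ord e; rewrite ltnS => ed.
  case: (ltngtP e m) => // em; case/negP: ab; rewrite -val_eqE /=.
    rewrite -(@eqn_pmul2r (m - e)) ?subn_gt0 //; apply/eqP; move: E.
    rewrite (_ : d - e = d - m + (m - e))%N; last by lia.
    by rewrite -{1}(subnK (ltnW em)) !mulnDr; lia.
  rewrite -(@eqn_pmul2r (e - m)) ?subn_gt0 //; apply/eqP; move: E.
  rewrite (_ : d - m = d - e + (e - m))%N; last by lia.
  by rewrite -{2}(subnK (ltnW em)) !mulnDr; lia.
have : \prod_(ab : 'I_n * 'I_n | ab.1 != ab.2) P ab.1 ab.2 != 0.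
  by apply/prodf_neq0 => ab; apply: P0.
case/closed_nonrootP => t; rewrite /root horner_prod => /prodf_neq0 nz.
exists (fun i => t ^+ i) => a b ab; have := nz (a, b) ab.
rewrite horner_sum; congr (_ != _); apply: eq_bigr => e _.
by rewrite hornerZ hornerXn exprD !exprM.
Qed.

Lemma traceless_values_slot n c : mlcoef c ->
  c o0 o1 o2 o3 + c o1 o0 o2 o3 != 0 -> traceless_values n c.
Proof.
move=> c0 cn; apply: traceless_values_hollow => // H hH.
have [|u uP] := @nonvanishing_form n (slot_sum c) 7 3 isT; first exact: cn.
pose Y := \matrix_(a, b) (H a b / \sum_(e < 8) slot_sum c e * (u a ^+ e * u b ^+ (7 - e))).
exists (fun i : 'I_4 => nth 0 [:: diag_mx (\row_i u i); diag_mx (\row_i u i ^+ 2); Y;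
  diag_mx (\row_i u i ^+ 4)] i).
apply/matrixP=> a b; rewrite (wsum_slot u Y a b c0) mxE.
have [<-|ab] := eqVneq a b; first by rewrite hH !mul0r.
by rewrite divfK // uP.
Qed.

Lemma wsum_commx c n (A : 'I_4 -> 'M[K]_n) : mlcoef c ->
    (forall i j k l, c i j k l + c j i k l = 0) ->
    (forall i j k l, c i j k l + c i j l k = 0) ->
  let T i j k l := c i j k l *: (commx (A i) (A j) *m commx (A k) (A l)) in
  wsum c A = T o0 o1 o2 o3 + T o2 o3 o0 o1 + T o0 o2 o1 o3 +
             T o1 o3 o0 o2 + T o0 o3 o1 o2 + T o1 o2 o0 o3.
Proof.
move=> c0 cl cr T; have TE i j k l : T i j k l =
    c i j k l *: (A i *m A j *m A k *m A l) + c i j l k *: (A i *m A j *m A l *m A k) +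
    c j i k l *: (A j *m A i *m A k *m A l) + c j i l k *: (A j *m A i *m A l *m A k).
  have clE k' l' : c j i k' l' = - c i j k' l' by apply/eqP; rewrite -addr_eq0 addrC cl.
  have crE : c i j l k = - c i j k l by apply/eqP; rewrite -addr_eq0 addrC cr.
  rewrite !clE crE opprK /T /commx !mulmxBl !mulmxBr !mulmxA.
  by apply/matrixP=> a b; move: (_ *m A k *m A l) => x; rewrite !mxE; ring.
by rewrite !TE wsumE.
Qed.

(** At [(u, x, y, u)] the terms containing [[u, u]] vanish and the others combine to [- p
    [u, x][u, y] - q [u, y][u, x]]. *)
Lemma traceless_values_pair n c : mlcoef c ->
    (forall i j k l, c i j k l + c j i k l = 0) ->
    (forall i j k l, c i j k l + c i j l k = 0) ->
    c o0 o1 o2 o3 + c o1 o3 o0 o2 != 0 ->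
  traceless_values n.+3 c.
Proof.
move=> c0 cl cr; set p := _ + _ => p0 D trD; pose q := c o2 o3 o0 o1 + c o0 o2 o1 o3.
have trD' : \tr (- p^-1 *: D) = 0 by rewrite mxtraceZ trD mulr0.
have [u [x [y E]]] := qcomm_value_traceless K0 (q / p) trD'.
have {}E : D = - p *: (commx u x *m commx u y) - q *: (commx u y *m commx u x).
  have pp : - p * - p^-1 = 1 by rewrite mulrNN mulfV.
  have pq : - p * (q / p) = - q by rewrite mulNr mulrC divfK.
  by rewrite -[LHS]scale1r -pp -scalerA -E scalerDr scalerA pq (scaleNr q).
exists (fun i : 'I_4 => nth u [:: u; x; y; u] i); rewrite wsum_commx //= E /p /q.
have commxC A B : commx A B = - commx B A :> 'M[K]_n.+3 by rewrite /commx opprB.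
have uu : commx u u = 0 by rewrite /commx subrr.
rewrite uu mul0mx mulmx0 !scaler0 !addr0 (commxC y u) (commxC x u).
rewrite !(mulmxN, mulNmx).
move: (commx u x *m commx u y) (commx u y *m commx u x) => a b.
by apply/matrixP=> i j; rewrite !mxE; ring.
Qed.

(** The relations determine all coefficients from [a] up to sign, and the polynomial is [a] times
    [s_4]. *)
Lemma traceless_values_std4 n c : mlcoef c ->
    (forall i j k l, c i j k l + c j i k l = 0) ->
    (forall i j k l, c i j k l + c i j l k = 0) ->
    (forall i j k l, uniq [:: i; j; k; l] -> c i j k l + c j l i k = 0) ->
    c o0 o1 o2 o3 != 0 ->
  traceless_values n.+3 c.
Proof.
move=> c0 cl cr cp; set a := c _ _ _ _ => a0 D trD.
have clE i j k l : c j i k l = - c i j k l by apply/eqP; rewrite -addr_eq0 addrC cl.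
have crE i j k l : c i j l k = - c i j k l by apply/eqP; rewrite -addr_eq0 addrC cr.
have cpE i j k l : uniq [:: i; j; k; l] -> c i j k l = - c j l i k.
  by move=> /cp e; apply/eqP; rewrite -addr_eq0 e.
have e1302 : c o1 o3 o0 o2 = - a by rewrite /a (cpE o0) // opprK.
have e2301 : c o2 o3 o0 o1 = a by rewrite cpE // clE crE opprK e1302 opprK.
have e0213 : c o0 o2 o1 o3 = - a by rewrite cpE // e2301.
have e0312 : c o0 o3 o1 o2 = a by rewrite cpE // clE e2301 opprK.
have e1203 : c o1 o2 o0 o3 = a by rewrite cpE // crE e2301 opprK.
have [|A [B [C [E AE]]]] := std4_value_traceless (D := a^-1 *: D) K0.
  by rewrite mxtraceZ trD mulr0.
exists (fun i : 'I_4 => nth A [:: A; B; C; E] i); rewrite wsum_commx //=.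
rewrite e1302 e2301 e0213 e0312 e1203 -/a.
rewrite -[RHS]scale1r -(mulfV a0) -scalerA -AE /std4.
move: (commx A B) (commx C E) (commx A C) (commx B E) (commx A E) (commx B C).
move=> x1 x2 x3 x4 x5 x6; move: (x1 *m x2) (x2 *m x1) (x3 *m x4) (x4 *m x3) (x5 *m x6) (x6 *m x5).
by move=> *; apply/matrixP=> i j; rewrite !mxE; ring.
Qed.

Definition word4 (i j k l : 'I_4) (x : 'I_4) := nth i [:: i; j; k; l] x.

Lemma word4_inj i j k l : uniq [:: i; j; k; l] -> injective (word4 i j k l).
Proof. by move=> u x y /eqP; rewrite nth_uniq // => /eqP/val_inj. Qed.

Lemma mlcoef_relabel c (h : 'I_4 -> 'I_4) : injective h -> mlcoef c ->
  mlcoef (fun i j k l => c (h i) (h j) (h k) (h l)).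
Proof.
by move=> hI c0 i j k l ul; apply: c0; rewrite -(map_inj_uniq hI [:: i; j; k; l]) in ul.
Qed.

Lemma traceless_values_mlcoef n c i j k l :
  mlcoef c -> c i j k l != 0 -> traceless_values n.+3 c.
Proof.
move=> c0 cn.
have relabel w : injective w -> let c' i j k l := c (w i) (w j) (w k) (w l) in
    mlcoef c' -> (mlcoef c' -> traceless_values n.+3 c') -> traceless_values n.+3 c.
  by move=> wI c' c0' v; apply: (traceless_values_relabel wI); apply: v.
(* Any offending word is relabelled to the identity word, where the previous lemmas apply. *)
have rl a b d e (u : uniq [:: a; b; d; e]) :=
  relabel _ (word4_inj u) (mlcoef_relabel (word4_inj u) c0).
have [/existsP[[[[a b] d] e] /= H]|/existsPn cl] :=
    boolP [exists w : 'I_4 * 'I_4 * 'I_4 * 'I_4,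
      let: (a, b, d, e) := w in c a b d e + c b a d e != 0].
  have u : uniq [:: a; b; d; e].
    apply: contraNT H => nu; rewrite !c0 ?addr0 //.
    by rewrite -(perm_uniq (s1 := [:: a; b; d; e])) // (perm_catCA [:: a] [:: b]).
  by apply: (rl _ _ _ _ u) => c0'; apply: traceless_values_slot.
have {}cl a b d e : c a b d e + c b a d e = 0.
  by apply/eqP; rewrite -[_ == _]negbK; apply: (cl (a, b, d, e)).
have [/existsP[[[[a b] d] e] /= H]|/existsPn cr] :=
    boolP [exists w : 'I_4 * 'I_4 * 'I_4 * 'I_4,
      let: (a, b, d, e) := w in c a b d e + c a b e d != 0].
  (* Symmetry in the last two places becomes symmetry in the first two after reversal, hence the
     reversed word. *)
  have u : uniq [:: e; d; b; a].
    apply: contraNT H; rewrite -rev_uniq /rev /= => nu; rewrite !c0 ?addr0 //.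
    by rewrite -(perm_uniq (s1 := [:: a; b; d; e])) // !perm_cons (perm_catCA [:: d] [:: e]).
  apply: (rl _ _ _ _ u) => c0'; apply: traceless_values_rev.
  apply: traceless_values_slot => // i' j' k' l'; rewrite -rev_uniq; exact: c0'.
have {}cr a b d e : c a b d e + c a b e d = 0.
  by apply/eqP; rewrite -[_ == _]negbK; apply: (cr (a, b, d, e)).
have [/existsP[[[[a b] d] e] /= /andP[u H]]|/existsPn cp] :=
    boolP [exists w : 'I_4 * 'I_4 * 'I_4 * 'I_4,
      let: (a, b, d, e) := w in
      uniq [:: a; b; d; e] && (c a b d e + c b e a d != 0)].
  by apply: (rl _ _ _ _ u) => c0'; apply: traceless_values_pair.
have u : uniq [:: i; j; k; l] by apply: contraNT cn => /c0->.
apply: (rl _ _ _ _ u) => c0'; apply: traceless_values_std4 => // a b d e.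
rewrite -(map_inj_uniq (word4_inj u)) /= => uw.
by apply/eqP; rewrite -[_ == _]negbK; have := cp (word4 i j k l a, word4 i j k l b, word4 i j k l d, word4 i j k l e); rewrite /= uw.
Qed.

End ClosedField.

(** * From noncommutative polynomials to coefficient sums, and the conclusion *)

Lemma nceval_multilinear (K : fieldType) n (a : 'S_4 -> K) (A : 'I_4 -> 'M[K]_n) :
  nceval (\sum_(s : 'S_4) a s *: \prod_(i < 4) ncvar K (s i)) A =
  wsum (fun i j k l => \sum_(s : 'S_4 |
          [&& s o0 == i, s o1 == j, s o2 == k & s o3 == l]) a s) A.
Proof.
(* Permutations are sorted by their four values, which determine them. *)
rewrite nceval_sum /wsum (partition_big (fun s : 'S_4 => s o0) predT) //=.
apply: eq_bigr => i _; rewrite (partition_big (fun s : 'S_4 => s o1) predT) //=.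
apply: eq_bigr => j _; rewrite (partition_big (fun s : 'S_4 => s o2) predT) //=.
apply: eq_bigr => k _; rewrite (partition_big (fun s : 'S_4 => s o3) predT) //=.
apply: eq_bigr => l _; rewrite scaler_suml.
apply: eq_big => [s|s /andP[/andP[/andP[/eqP si /eqP sj] /eqP sk] /eqP sl]].
  by rewrite !andbA.
rewrite ncevalZ; congr (_ *: _).
have prodE (V : pzRingType) (F : 'I_4 -> V) : \prod_i F i = F o0 * F o1 * F o2 * F o3.
  rewrite !big_ord_recl big_ord0 mulr1 !mulrA.
  by congr (F _ * F _ * F _ * F _); apply: val_inj.
by rewrite prodE !ncevalM !nceval_var si sj sk sl !mulmxE.
Qed.

Theorem theorem1 (n : nat) (hn : (3 <= n)%N)
    (K : closedFieldType) (hK : [pchar K] =i pred0)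
    (f : {ncpoly K[4]}) (hf : multilinear f) (f_neq0 : f != 0)
    (D : 'M[K]_n) (hD : \tr D = 0) :
  exists A : 'I_4 -> 'M[K]_n, nceval f A = D.
Proof.
case: n hn D hD => [|[|[|n]]] // _ D trD; case: hf => a fE.
have [s as0] : exists s, a s != 0.
  apply/existsP; apply: contraNT f_neq0; rewrite negb_exists => /forallP a0.
  rewrite fE big1 // => s _; have := a0 s; rewrite negbK => /eqP->.
  by rewrite scale0r.
pose c i j k l := \sum_(s : 'S_4 |
  [&& s o0 == i, s o1 == j, s o2 == k & s o3 == l]) a s.
have c0 : mlcoef c.
  move=> i j k l; apply: contraNeq => cn.
  have /existsP[t /and4P[/eqP<- /eqP<- /eqP<- /eqP<-]] :
      [exists t : 'S_4, [&& t o0 == i, t o1 == j, t o2 == k & t o3 == l]].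
    apply: contraNT cn; rewrite negb_exists => /forallP nt.
    by rewrite /c big_pred0 // => t; apply: negbTE.
  by rewrite -[X in uniq X]/(map t [:: o0; o1; o2; o3]) (map_inj_uniq perm_inj).
(* Only [s] itself takes these four values, so this coefficient is [a s]. *)
have cs : c (s o0) (s o1) (s o2) (s o3) != 0.
  rewrite /c (big_pred1 s) // => t /=; apply/and4P/eqP => [[/eqP t0 /eqP t1 /eqP t2 /eqP t3]|->].
    apply/permP => -[[|[|[|[|i]]]] // hi].
    - by rewrite (_ : Ordinal hi = o0) //; apply: val_inj.
    - by rewrite (_ : Ordinal hi = o1) //; apply: val_inj.
    - by rewrite (_ : Ordinal hi = o2) //; apply: val_inj.
    - by rewrite (_ : Ordinal hi = o3) //; apply: val_inj.
  by rewrite !eqxx.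
have [A AE] := traceless_values_mlcoef hK c0 cs trD.
by exists A; rewrite fE nceval_multilinear.
Qed.
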